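(* Let $\mathfrak g$ be a semisimple complex Lie algebra, let $\theta\in\operatorname{Aut}\mathfrak g$ be an element of order $2$ with $\mathfrak k=\{x\in\mathfrak g\mid\theta(x)=x\}$ and $\mathfrak p=\{x\in\mathfrak g\mid\theta(x)=-x\}$. Let $e\in\mathcal N(\mathfrak p)_{\rm pr}$ be a principal nilpotent element of $\mathfrak p$, included in an $\mathfrak{sl}_2$-triple $\{e,h,f\}$ in $\mathfrak g$ such that $h\in\mathfrak k$ and $e,f\in\mathfrak p$, and for $d\in\mathbb Z$ let $\mathfrak g_d=\{x\in\mathfrak g\mid[h,x]=dx\}$. Then $$\dim(\mathfrak g_0\cap\mathfrak p)=\dim(\mathfrak g_2\cap\mathfrak k).$$
   Context: $G$ is the adjoint group of $\mathfrak g$, and $K$ is the connected (reductive algebraic) subgroup of $G$ with Lie algebra $\mathfrak k$; it acts on $\mathfrak p$ by the adjoint action. $\mathcal N(\mathfrak p)$ is the Zariski closed set of all elements $x\in\mathfrak p$ with $\operatorname{ad}x$ nilpotent on $\mathfrak g$. There are only finitely many $K$-orbits in $\mathcal N(\mathfrak p)$, so every irreducible component of $\mathcal N(\mathfrak p)$ contains an open $K$-orbit; $\mathcal N(\mathfrak p)_{\rm pr}$ is the union of these open orbits, and its elements are the principal nilpotent elements of $\mathfrak p$. An $\mathfrak{sl}_2$-triple is an ordered triple $\{e,h,f\}$ of elements of $\mathfrak g$ with $[h,e]=2e$, $[h,f]=-2f$, $[e,f]=h$. Every nonzero $e\in\mathcal N(\mathfrak p)$ can be included in an $\mathfrak{sl}_2$-triple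 with $h\in\mathfrak k$, $e,f\in\mathfrak p$. *)

(* Defs.v *)
From HB Require Import structures.
From mathcomp Require Export all_boot all_order all_algebra.
From mathcomp Require Export all_classical reals topology complex.
(* Notations not imported: they clash with those of topology. *)
From mathcomp Require Export(canonicals, coercions) mpoly.

Set Implicit Arguments.
Unset Strict Implicit.
Unset Printing Implicit Defensive.

Import GRing.Theory.

Local Open Scope classical_set_scope.
Local Open Scope ring_scope.

HB.mixin Record Vector_isLieAlgebra (F : fieldType) g of Vector F g := {
  lie : g -> g -> g;
  lie_linearl : forall y, linear (lie^~ y);
  lie_linearr : forall x, linear (lie x);
  liexx : forall x, lie x x = 0;
  lie_jacobi : forall x y z,
    lie x (lie y z) + lie y (lie z x) + lie z (lie x y) = 0
}.

#[short(type="lieAlgType")]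
HB.structure Definition LieAlgebra (F : fieldType) :=
  {g of Vector_isLieAlgebra F g & Vector F g}.

Notation "[lie x , y ]" := (lie x y)
  (at level 0, x, y at level 99, format "[lie  x ,  y ]") : ring_scope.

HB.instance Definition _ (F : fieldType) (g : lieAlgType F) (x : g) :=
  GRing.isLinear.Build F g g *:%R (lie x) (lie_linearr x).

Section LieAlgebras.
Variables (F : fieldType) (g : lieAlgType F).
Implicit Types (I J : {vspace g}) (x y e h f : g) (phi : 'End(g)).

Definition ad x : 'End(g) := linfun (lie x).

Definition lie_commutator I J : {vspace g} :=
  <<[seq [lie x, y] | x <- vbasis I, y <- vbasis J]>>%VS.

Definition derived_series I (n : nat) : {vspace g} :=
  iter n (fun J => lie_commutator J J) I.

Definition lie_solvable I : Prop := exists n, derived_series I n = 0%VS.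

Definition lie_ideal I : Prop := forall x y, y \in I -> [lie x, y] \in I.

Definition lie_semisimple : Prop :=
  forall I, lie_ideal I -> lie_solvable I -> I = 0%VS.

Definition lie_automorphism phi : Prop :=
  lker phi = 0%VS /\ forall x y, phi [lie x, y] = [lie phi x, phi y].

Definition ad_nilpotent x : Prop := exists n, forall y, iter n (ad x) y = 0.

Definition ad_eigenspace h (d : int) : {vspace g} :=
  passmx.leigenspace (ad h) d%:~R.

Definition sl2_triple e h f : Prop :=
  [/\ [lie h, e] = 2%:R *: e, [lie h, f] = - 2%:R *: f & [lie e, f] = h].

End LieAlgebras.

Section Coordinates.
Variables (F : fieldType) (V : vectType F).

Definition polyfun := mpoly.mpoly (\dim {:V}) F.

Definition coordinates (v : V) : 'I_(\dim {:V}) -> F :=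
  fun i => coord (vbasis {:V}) i v.

Definition peval (P : polyfun) (v : V) : F := mpoly.meval (coordinates v) P.

(* The derivative of P at v in the direction w. *)
Definition pderiv (P : polyfun) (v w : V) : F :=
  \sum_i peval (mpoly.mderiv i P) v * coordinates w i.

Definition zero_locus (S : set polyfun) : set V :=
  [set v | forall P, S P -> peval P v = 0].

Definition zariski_open (U : set V) : Prop :=
  exists S : set polyfun, U = ~` zero_locus S.

Lemma zariski_openT : zariski_open setT.
Proof.
exists [set (1 : mpoly.mpoly _ F)]; apply/seteqP; split => // v _ /(_ 1 erefl) /eqP.
by rewrite /peval rmorph1 oner_eq0.
Qed.

Lemma zariski_openI (A B : set V) :
  zariski_open A -> zariski_open B -> zariski_open (A `&` B).
Proof.
move=> [S ->] [T ->].
exists [set P | exists2 Q, S Q & exists2 Q', T Q' & P = Q * Q'].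
rewrite -setCU; congr (~` _); apply/seteqP; split => v.
  case=> zv P [Q SQ [Q' TQ' ->]]; rewrite /peval rmorphM /=.
    by move: (zv Q SQ); rewrite /peval => ->; rewrite mul0r.
  by move: (zv Q' TQ'); rewrite /peval => ->; rewrite mulr0.
move=> zv; have [|/existsNP[Q /not_implyP[SQ /eqP Qv]]] :=
  pselect (zero_locus S v); first by left.
right=> Q' TQ'; have /eqP : peval (Q * Q' : mpoly.mpoly _ F) v = 0.
  by apply: zv; exists Q => //; exists Q'.
by rewrite /peval rmorphM mulf_eq0 -/(peval Q v) (negPf Qv) => /eqP.
Qed.

Lemma zariski_open_bigcup (I : Type) (f : I -> set V) :
  (forall i, zariski_open (f i)) -> zariski_open (\bigcup_i f i).
Proof.
move=> fop; have /choice[S fS] := fop.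
exists (\bigcup_i S i); rewrite -[LHS]setCK setC_bigcup; congr (~` _).
apply/seteqP; split => v.
  move=> zv P [i _ SP]; have := zv i Logic.I; rewrite fS setCK; exact.
by move=> zv i _; rewrite fS setCK => P SP; apply: zv; exists i.
Qed.

End Coordinates.

(* An alias of V, so that the Zariski topology does not clash with other
   topologies on V. *)
Definition zariski (F : fieldType) (V : vectType F) : Type := V.

HB.instance Definition _ (F : fieldType) (V : vectType F) :=
  Choice.on (zariski V).

HB.instance Definition _ (F : fieldType) (V : vectType F) :=
  isOpenTopological.Build (zariski V) (@zariski_openT F V)
    (@zariski_openI F V) (@zariski_open_bigcup F V).

Section Irreducibility.
Variable T : topologicalType.
Implicit Types A B C O : set T.

Definition irreducible A : Prop :=
  A !=set0 /\ forall C D, closed C -> closed D ->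
    A `<=` C `|` D -> A `<=` C \/ A `<=` D.

Definition irreducible_component A B : Prop :=
  [/\ B `<=` A, irreducible B &
      forall C, C `<=` A -> irreducible C -> B `<=` C -> C = B].

Definition open_in A O : Prop := exists2 U, open U & O = A `&` U.

End Irreducibility.

Section AlgebraicGroups.
Variables (F : fieldType) (V : vectType F).
Implicit Types (H : set 'End(V)).

Definition GL : set 'End(V) := [set f | lker f = 0%VS].

Definition linear_group H : Prop :=
  [/\ H `<=` GL, H \1%VF,
      forall f f', H f -> H f' -> H (f \o f')%VF &
      forall f, H f -> H (f^-1)%VF].

(* Closedness is relative to GL, which is itself Zariski open in 'End(V). *)
Definition algebraic_group H : Prop :=
  linear_group H /\
  exists2 Z : set (zariski 'End(V)), closed Z & H = GL `&` Z.

(* The tangent space at the identity of the Zariski closed set H. *)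
Definition lie_algebra_of H : set 'End(V) :=
  [set X | forall P : polyfun 'End(V),
     (forall f, H f -> peval P f = 0) -> pderiv P \1%VF X = 0].

Definition connected_algebraic_group H : Prop :=
  algebraic_group H /\ connected (H : set (zariski 'End(V))).

Definition orbit_of H (x : V) : set V := [set (f : 'End(V)) x | f in H].

End AlgebraicGroups.

Section SymmetricPairs.
Variables (F : fieldType) (g : lieAlgType F).
Implicit Types (G K : set 'End(g)) (k p : {vspace g}) (theta : 'End(g)).

(* The connected algebraic subgroup of Aut g whose Lie algebra is ad g; it
   exists because g is semisimple (it is the identity component of Aut g). *)
Definition adjoint_group G : Prop :=
  [/\ connected_algebraic_group G,
      forall phi, G phi -> lie_automorphism phi &
      lie_algebra_of G = [set ad x | x in [set: g]]].

(* A subalgebra k of g is identified with ad k, the adjoint representation of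
   a semisimple Lie algebra being faithful. *)
Definition connected_subgroup_with_lie_algebra G K k : Prop :=
  [/\ connected_algebraic_group K, K `<=` G &
      lie_algebra_of K = [set ad x | x in [set x | x \in k]]].

Definition automorphism_of_order2 theta : Prop :=
  [/\ lie_automorphism theta, (theta \o theta)%VF = \1%VF &
      theta <> \1%VF].

Definition nilpotent_cone p : set g :=
  [set x | x \in p /\ ad_nilpotent x].

(* The orbit of x is relatively open in an irreducible component, which by
   open_in also contains it. *)
Definition principal_nilpotent K p : set g :=
  [set x | exists2 X : set (zariski g),
     irreducible_component (nilpotent_cone p : set (zariski g)) X &
     open_in X (orbit_of K x)].

End SymmetricPairs.

(* Main.v *)
(* The maps ad e : g_0 /\ p -> g_2 /\ k and ad f : g_2 /\ k -> g_0 /\ p are both injective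
   as soon as no nonzero x in p commutes with e, h and f.  The slice e + p^f meets N(p) only
   in e: the contracting action of exp (t h) joins a nilpotent point of the slice to e by a
   curve in N(p), which by irreducibility of K meets the open orbit K e, while a point of K e
   in the slice is e itself.  Let x in p commute with the triple.  If ad x is nilpotent, so
   is ad (e + x), and x = 0.  Otherwise some v in k moves e + x inside the slice, and Cramer's
   rule extends this direction to a nonzero polynomial vector field on the slice which is
   pointwise tangent to brackets with elements of g, and so kills the functions tr (ad y)^j.
   These are homogeneous for positive weights and vanish together only at e, hence the
   coordinate ring of the slice is finite over the ring they generate (Nullstellensatz);
   a derivation killing that subring is zero, a contradiction. *)
From HB Require Import structures.
Require Import Defs.
From mathcomp Require Import ring lra zify.

Set Implicit Arguments.
Unset Strict Implicit.
Unset Printing Implicit Defensive.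

Import Order.TTheory GRing.Theory Num.Theory passmx.
Local Open Scope classical_set_scope.
Local Open Scope ring_scope.

(** Semisimplicity enters only through the absence of nonzero abelian ideals; neither the Killing
    form nor complete reducibility is used. One obstacle is that [K] is known only through its Lie
    algebra, while its translates of the curve must stay in N(p): [K] has to preserve p. Conjugation
    invariance of Lie(K) gives that [K] preserves k, and p follows from the vanishing of a
    derivation of square zero that kills k. The group exp (t h) is never formed: on the slice the
    traces of powers of ad y are weighted homogeneous, and this alone makes every point of the
    rescaled curve nilpotent. Likewise the Nullstellensatz is proved only for uncountable fields,
    where counting dimensions suffices. *)

Section Iter.
Variables (F : fieldType) (V : vectType F).
Implicit Types (phi psi : 'End(V)) (U : {vspace V}).

(** * Linear algebra: nilpotent endomorphisms and eigenbases *)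

Lemma iter_lfun0 phi n : iter n phi 0 = 0.
Proof. by elim: n => //= n ->; rewrite linear0. Qed.

Lemma iter_lfunD phi n u v : iter n phi (u + v) = iter n phi u + iter n phi v.
Proof. by elim: n => //= n ->; rewrite linearD. Qed.

Lemma iter_lfunZ phi n a u : iter n phi (a *: u) = a *: iter n phi u.
Proof. by elim: n => //= n ->; rewrite linearZ. Qed.

Lemma iter_lfunN phi n u : iter n phi (- u) = - iter n phi u.
Proof. by rewrite -scaleN1r iter_lfunZ scaleN1r. Qed.

Lemma iter_lfun_comm phi psi n u :
  (forall z, phi (psi z) = psi (phi z)) ->
  iter n phi (psi u) = psi (iter n phi u).
Proof. by move=> c; elim: n => //= n ->. Qed.

Definition lfun_nilpotent phi := exists n, forall z, iter n phi z = 0.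

Definition lfun_power phi n : 'End(V) := iter n (fun f => (phi \o f)%VF) \1%VF.

Lemma lfun_powerE phi n z : lfun_power phi n z = iter n phi z.
Proof. by elim: n => [|n IH]; rewrite ?id_lfunE //= comp_lfunE IH. Qed.

Lemma nilpotent_last phi u : (exists n, iter n phi u = 0) -> u != 0 ->
  exists n, iter n phi u != 0 /\ phi (iter n phi u) = 0.
Proof.
case=> n; elim: n u => [|n IH] u /= un u0; first by rewrite un eqxx in u0.
have [z0|z0] := eqVneq (iter n phi u) 0; first exact: IH.
by exists n.
Qed.

Definition eprod phi (s : seq F) : 'End(V) :=
  foldr (fun c f => (f \o (phi - c *: \1))%VF) \1%VF s.

Lemma eprod_cons phi c s z : eprod phi (c :: s) z = eprod phi s (phi z - c *: z).
Proof. by rewrite /= comp_lfunE add_lfunE opp_lfunE scale_lfunE id_lfunE. Qed.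

Lemma eprod_eig phi s c z : phi z = c *: z ->
  eprod phi s z = (\prod_(b <- s) (c - b)) *: z.
Proof.
elim: s z => [|b s IH] z hz; first by rewrite big_nil scale1r id_lfunE.
rewrite eprod_cons hz -scalerBl linearZ /= IH // big_cons scalerA //.
Qed.

Lemma eigenvectors_free phi (X : seq (F * V)) :
  uniq (map fst X) -> (forall x, x \in X -> x.2 != 0 /\ phi x.2 = x.1 *: x.2) ->
  free (map snd X).
Proof.
elim: X => [|[c v] X IH] /=; first by rewrite nil_free.
case/andP=> cX uX hX; rewrite free_cons IH //; last first.
  by move=> x xX; apply: hX; rewrite inE xX orbT.
rewrite andbT; apply/negP => vX.
have [/= v0 hv] := hX (c, v) (mem_head _ _).
have : v \in lker (eprod phi (map fst X)).
  apply: subvP vX; apply/span_subvP => w /mapP[[b u] /= xX ->].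
  have [/= _ hu] := hX (b, u) (@mem_behead _ (_ :: _) _ xX).
  rewrite memv_ker (eprod_eig _ hu) big_map (big_rem _ xX) /= subrr mul0r.
  by rewrite scale0r.
rewrite memv_ker (eprod_eig _ hv) scaler_eq0 (negPf v0) orbF big_map.
rewrite prodf_seq_eq0 => /hasP[[b u] bX /= ]; rewrite subr_eq0 => /eqP cb.
by case/negP: cX; apply/mapP; exists (b, u).
Qed.

(** Induction on [s]: with [psi = phi - c], [U] is the sum of its part in ker psi and of [psi @: U].
    The sum is direct because [c] is not in [s], whose product kills [psi @: U]; it fills [U] by
    rank and nullity. *)
Lemma eigenbasis phi s U : uniq s ->
  (forall z, z \in U -> phi z \in U) ->
  (forall z, z \in U -> eprod phi s z = 0) ->
  exists2 X : seq V, basis_of U X &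
    forall x, x \in X -> exists2 c, c \in s & phi x = c *: x.
Proof.
elim: s U => [|c s IH] U /=.
  move=> _ _ h; exists [::] => //; suff -> : U = 0%VS by rewrite /basis_of span_nil eqxx nil_free.
  apply/eqP; rewrite -subv0; apply/subvP=> z /h; rewrite id_lfunE => ->.
  exact: mem0v.
case/andP=> cs us st ann; pose psi := phi - c *: \1%VF.
have psiE z : psi z = phi z - c *: z by rewrite add_lfunE opp_lfunE scale_lfunE id_lfunE.
have [|z /memv_imgP[u uU ->]|X2 bX2 hX2] := IH (psi @: U)%VS us.
- move=> z /memv_imgP[u uU ->]; rewrite !psiE linearB linearZ /= -psiE.
  by apply: memv_img; apply: st.
- by have := ann _ uU; rewrite comp_lfunE.
pose U1 := (U :&: lker psi)%VS; have hU1 z : z \in U1 -> phi z = c *: z.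
  by rewrite memv_cap memv_ker psiE subr_eq0 => /andP[_ /eqP].
have sub2 : (psi @: U <= U)%VS.
  apply/subvP=> z /memv_imgP[u uU ->]; rewrite psiE memvB ?memvZ //; exact: st.
have dxU : directv (U1 + psi @: U).
  apply/directv_addP/eqP; rewrite -subv0; apply/subvP=> z.
  rewrite memv_cap => /andP[/hU1 hz /memv_imgP[u uU zE]].
  have := ann _ uU; rewrite comp_lfunE -zE (eprod_eig _ hz) => /eqP.
  rewrite scaler_eq0 prodf_seq_eq0 memv0 => /orP[|//].
  case/hasP => b bs; rewrite /= subr_eq0 => /eqP cb.
  by rewrite cb bs in cs.
have eqU : (U1 + psi @: U)%VS = U.
  apply/eqP; rewrite eqEdim subv_add capvSl sub2 /=.
  by rewrite (directvP dxU) /= limg_ker_dim.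
exists (vbasis U1 ++ X2).
  by rewrite -eqU cat_basis ?vbasisP.
move=> x; rewrite mem_cat => /orP[/vbasis_mem/hU1 hx|/hX2[b bs hb]].
  by exists c; rewrite ?mem_head.
by exists b; rewrite // inE bs orbT.
Qed.

End Iter.

(** The powers of [psi] are eigenvectors of the commutator with [phi], for the distinct eigenvalues
    [n * c]. If none vanished, End(V) would contain too many independent vectors. *)
Lemma ladder_nilpotent (F : numFieldType) (V : vectType F) (phi psi : 'End(V)) c :
  c != 0 -> (forall z, phi (psi z) = psi (phi z) + c *: psi z) -> lfun_nilpotent psi.
Proof.
move=> c0 h.
pose T := linfun (fun X : 'End(V) => (phi \o X)%VF - (X \o phi)%VF : 'End(V)).
have Tlin : linear (fun X : 'End(V) => (phi \o X)%VF - (X \o phi)%VF : 'End(V)).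
  move=> a X Y; rewrite comp_lfunDl comp_lfunDr -comp_lfunZl -comp_lfunZr.
  by rewrite scalerBr opprD addrACA.
pose Tl : {linear 'End(V) -> 'End(V)} := HB.pack
  (fun X : 'End(V) => (phi \o X)%VF - (X \o phi)%VF : 'End(V))
  (GRing.isLinear.Build _ _ _ _ _ Tlin).
have TE n : linfun Tl (lfun_power psi n) = (n%:R * c) *: lfun_power psi n.
  rewrite lfunE /=; apply/lfunP => z.
  rewrite add_lfunE opp_lfunE !comp_lfunE scale_lfunE; apply/eqP; rewrite subr_eq !lfun_powerE; apply/eqP.
  elim: n => [|n IH] /=; first by rewrite mul0r scale0r add0r.
  by rewrite h IH linearD linearZ /= addrAC -scalerDl -[n.+1%:R]natr1 mulrDl mul1r.
pose D := \dim {: 'End(V)}.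
have [/hasP[n _ /eqP hn]|/hasPn none] :=
  boolP (has (fun i => lfun_power psi i == 0) (iota 0 D.+1)).
  by exists n => z; rewrite -lfun_powerE hn zero_lfunE.
pose X := [seq (i%:R * c, lfun_power psi i) | i <- iota 0 D.+1].
have frX : free (map snd X).
  apply: (@eigenvectors_free _ _ (linfun Tl)) => [|x /mapP[i /none i0 ->]]; last by split; last exact: TE.
  rewrite -map_comp map_inj_uniq ?iota_uniq // => i j /(mulIf c0)/eqP.
  by rewrite eqr_nat => /eqP.
by have := dimvS (subvf <<map snd X>>); rewrite (eqP frX) !size_map size_iota ltnn.
Qed.

(** * Representations of sl2 *)

Section Sl2.
Variables (F : numFieldType) (V : vectType F).

Record sl2_rep (E H G : 'End(V)) : Prop := Sl2Rep {
  sl2_HE : forall z, H (E z) = E (H z) + 2%:R *: E z;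
  sl2_HG : forall z, H (G z) = G (H z) - 2%:R *: G z;
  sl2_EG : forall z, E (G z) = G (E z) + H z }.

Lemma sl2_rep_sym E H G : sl2_rep E H G -> sl2_rep G (- H) E.
Proof.
case=> hE hG hEG; split=> z; rewrite ?opp_lfunE ?hE ?hG ?hEG.
- by rewrite opprB linearN /= addrC.
- by rewrite linearN opprD.
- by rewrite addrK.
Qed.

Lemma sl2_rep_nilpotent E H G : sl2_rep E H G -> lfun_nilpotent E /\ lfun_nilpotent G.
Proof.
case=> hE hG _; split.
  by apply: (@ladder_nilpotent _ _ H _ 2%:R); rewrite ?pnatr_eq0.
apply: (@ladder_nilpotent _ _ H _ (- 2%:R)); rewrite ?oppr_eq0 ?pnatr_eq0 //.
by move=> z; rewrite hG scaleNr.
Qed.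

Section Rep.
Variables (E H G : 'End(V)).
Hypothesis rep : sl2_rep E H G.

Lemma sl2_HG_iter n z : H (iter n G z) = iter n G (H z) - (2 * n)%:R *: iter n G z.
Proof.
elim: n => [|n IH] /=; first by rewrite scale0r subr0.
rewrite (sl2_HG rep) IH linearB linearZ /= -addrA -opprD -scalerDl -natrD.
by rewrite mulnS addnC.
Qed.

Lemma sl2_HE_iter n z : H (iter n E z) = iter n E (H z) + (2 * n)%:R *: iter n E z.
Proof.
elim: n => [|n IH] /=; first by rewrite scale0r addr0.
rewrite (sl2_HE rep) IH linearD linearZ /= -addrA -scalerDl -natrD.
by rewrite mulnS addnC.
Qed.

Lemma sl2_EG_iter n z : E z = 0 ->
  E (iter n.+1 G z) = n.+1%:R *: iter n G (H z - n%:R *: z).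
Proof.
move=> Ez; rewrite iter_lfunD iter_lfunN iter_lfunZ.
elim: n => [|n IH].
  by rewrite /= (sl2_EG rep) Ez linear0 add0r scale0r subr0 scale1r.
rewrite iterS (sl2_EG rep) IH sl2_HG_iter linearZ linearB linearZ /= -!iterS.
set a := iter _ _ (H z); set b := iter _ _ z.
rewrite !scalerBr addrACA -{2}[a]scale1r -scalerDl natr1 -opprD !scalerA -scalerDl.
congr (_ *: _ - _ *: _); rewrite -!natrM -natrD; congr (_%:R); lia.
Qed.

Lemma sl2_kerE_H z : E z = 0 -> E (H z) = 0.
Proof.
move=> Ez; have := sl2_HE rep z; rewrite Ez linear0 scaler0 addr0.
by move=> <-.
Qed.

Lemma sl2_kerE_prod n z : E z = 0 ->
  iter n E (iter n G z) = n`!%:R *: eprod H (rev [seq i%:R | i <- iota 0 n]) z.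
Proof.
elim: n z => [|n IH] z Ez; first by rewrite /= id_lfunE scale1r.
rewrite iterSr sl2_EG_iter // iter_lfunZ IH; last first.
  by rewrite linearB linearZ /= sl2_kerE_H // Ez scaler0 subr0.
have -> : iota 0 n.+1 = rcons (iota 0 n) n by rewrite -cats1 -[n.+1]addn1 iotaD.
by rewrite map_rcons rev_rcons eprod_cons scalerA factS natrM.
Qed.

End Rep.

(* Via E^n G^n = n! H (H - 1) ... (H - n + 1) on the kernel of E. *)
Lemma sl2_kerE_annihilated E H G : sl2_rep E H G ->
  exists n, forall z, E z = 0 -> eprod H (rev [seq i%:R | i <- iota 0 n]) z = 0.
Proof.
move=> rep; have [_ [n hn]] := sl2_rep_nilpotent rep; exists n => z Ez.
have := sl2_kerE_prod rep n Ez; rewrite hn iter_lfun0 => /esym/eqP.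
by rewrite scaler_eq0 pnatr_eq0 eqn0Ngt fact_gt0 => /eqP.
Qed.

Lemma uniq_rev_iotaR n : uniq (rev [seq i%:R : F | i <- iota 0 n]).
Proof.
rewrite rev_uniq map_inj_uniq ?iota_uniq // => i j /eqP.
by rewrite eqr_nat => /eqP.
Qed.

Lemma sl2_kerE_weight E H G : sl2_rep E H G ->
  exists n, forall c z, E z = 0 -> H z = c *: z -> z != 0 -> exists2 i, (i < n)%N & c = i%:R.
Proof.
move=> rep; have [n hn] := sl2_kerE_annihilated rep; exists n => c z Ez Hz z0.
have := hn z Ez; rewrite (eprod_eig _ Hz) => /eqP.
rewrite scaler_eq0 (negPf z0) orbF prodf_seq_eq0 has_rev has_map => /hasP[i ii /=].
by move: ii; rewrite mem_iota add0n subr_eq0 => ltin /eqP ->; exists i.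
Qed.

(** On ker E, [H] is annihilated by a product of distinct factors [H - i], hence diagonalizable. *)
Lemma sl2_kerE_eigenbasis E H G U : sl2_rep E H G ->
  (U <= lker E)%VS -> (forall z, z \in U -> H z \in U) ->
  exists2 X : seq V, basis_of U X &
    forall x, x \in X -> exists i, H x = i%:R *: x.
Proof.
move=> rep /subvP sU st; have [n hn] := sl2_kerE_annihilated rep.
have [|X bX hX] := eigenbasis (uniq_rev_iotaR n) st.
  by move=> z /sU; rewrite memv_ker => /eqP; apply: hn.
exists X => // x xX; have [c cs Hx] := hX x xX; have := eprod_eig (rev [seq i%:R | i <- iota 0 n]) Hx.
have [-> |x0] := eqVneq x 0; first by exists 0%N; rewrite linear0 scaler0.
have Ex : E x = 0.
  have xU : x \in U := basis_mem bX xX.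
  by move: (sU _ xU); rewrite memv_ker => /eqP.
rewrite hn //; move=> /esym/eqP; rewrite scaler_eq0 (negPf x0) orbF prodf_seq_eq0 has_rev has_map.
by case/hasP=> i _ /=; rewrite subr_eq0 => /eqP ci; exists i; rewrite Hx ci.
Qed.

Lemma sl2_kerG_weight E H G : sl2_rep E H G ->
  exists n, forall c z, G z = 0 -> H z = c *: z -> z != 0 -> exists2 i, (i < n)%N & c = - i%:R.
Proof.
move=> /sl2_rep_sym/sl2_kerE_weight[n hn]; exists n => c z Gz Hz z0.
have [||i lt ci] := hn (- c) z Gz => //; first by rewrite opp_lfunE Hz scaleNr.
by exists i; rewrite // -ci opprK.
Qed.

Lemma sl2_kerG_eigenbasis E H G U : sl2_rep E H G ->
  (U <= lker G)%VS -> (forall z, z \in U -> H z \in U) ->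
  exists2 X : seq V, basis_of U X &
    forall x, x \in X -> exists i, H x = - i%:R *: x.
Proof.
move=> /sl2_rep_sym rep sU st.
have [|X bX hX] := sl2_kerE_eigenbasis rep sU.
  by move=> z zU; rewrite opp_lfunE memvN st.
exists X => // x /hX[i /eqP]; rewrite opp_lfunE eqr_oppLR -scaleNr => /eqP hi.
by exists i.
Qed.

(** The space [limg E :&: lker G] has a basis of weight vectors; let [l = E v] be one, of weight
    [-k]. As ker E has only weights in the natural numbers, [H + (k + 2)] is bijective on it, so [v]
    can be corrected by an element of ker E to have weight exactly [-(k + 2)]. *)
Lemma sl2_imE_kerG E H G z : sl2_rep E H G -> G (E z) = 0 -> E z = 0.
Proof.
move=> rep GEz; set U := (limg E :&: lker G)%VS.
have [_ [N GN]] := sl2_rep_nilpotent rep.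
have [n wE] := sl2_kerE_weight rep.
have kerG u : u \in lker G -> H u \in lker G.
  rewrite !memv_ker => /eqP Eu; have := sl2_kerE_H (sl2_rep_sym rep) Eu.
  by rewrite opp_lfunE linearN => /eqP; rewrite oppr_eq0.
have [||X bX hX] := @sl2_kerG_eigenbasis E H G U rep; first exact: capvSr.
  move=> u; rewrite !memv_cap => /andP[/memv_imgP[v _ ->] /kerG ->].
  rewrite (sl2_HE rep) -linearZ -linearD /=.
  by rewrite memv_img ?memvf.
suff U0 : U = 0%VS.
  by apply/eqP; rewrite -memv0 -U0 memv_cap memv_img ?memvf //= memv_ker GEz.
apply/eqP; rewrite -subv0 -(span_basis bX); apply/span_subvP => l lX.
have := basis_mem bX lX; rewrite memv_cap memv_ker memv0.
case/andP=> /memv_imgP[v _ lE] /eqP Gl; have [k Hl] := hX _ lX.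
pose psi := H + k.+2%:R *: \1%VF.
have psiE u : psi u = H u + k.+2%:R *: u by rewrite add_lfunE scale_lfunE id_lfunE.
have psik : (psi @: lker E)%VS = lker E.
  apply/eqP; rewrite eqEdim limg_dim_eq; last first.
    apply/eqP; rewrite -subv0; apply/subvP => u.
    rewrite memv_cap !memv_ker psiE addr_eq0 memv0 => /andP[/eqP Eu /eqP Hu].
    apply: contraT => u0; have [|i _] := wE (- k.+2%:R) u Eu _ u0.
      by rewrite Hu scaleNr.
    move/eqP; rewrite eq_sym -addr_eq0 -natrD pnatr_eq0; lia.
  rewrite leqnn andbT; apply/subvP=> u /memv_imgP[w].
  rewrite !memv_ker psiE => /eqP Ew ->.
  by rewrite linearD linearZ /= (sl2_kerE_H rep) // Ew scaler0 addr0.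
have : psi v \in lker E.
  rewrite memv_ker psiE linearD linearZ /= -lE.
  have -> : E (H v) = H l - 2%:R *: l by rewrite lE (sl2_HE rep) addrK.
  by rewrite Hl -addrA -scaleNr -!scalerDl (_ : _ + _ = 0) ?scale0r // -natr1 -natr1; ring.
rewrite -psik => /memv_imgP[m]; rewrite memv_ker => /eqP Em psim.
have {v psim lE} [v Hv lE] : exists2 v, H v = - k.+2%:R *: v & l = E v.
  exists (v - m); last by rewrite linearB /= Em subr0.
  have : psi (v - m) = 0 by rewrite linearB /= psim subrr.
  by move/eqP; rewrite psiE addr_eq0 scaleNr => /eqP.
(* None of these coefficients vanishes, so [G ^ j v = 0] propagates down to [v = 0]; it holds for
   large [j] as [G] is nilpotent. *)
have EG j : E (iter j.+1 G v) = - (j.+1 * (k.+2 + j))%:R *: iter j G v.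
  elim: j => [|j IH].
    by rewrite /= (sl2_EG rep) -lE Gl add0r Hv addn0 mul1n.
  rewrite iterS (sl2_EG rep) IH (sl2_HG_iter rep) Hv iter_lfunZ linearZ /= -iterS.
  rewrite -scaleNr -!scalerDl; congr (_ *: _).
  rewrite -!opprD -!natrD; congr (- _%:R); lia.
have Gv j : iter j G v = 0 -> v = 0.
  elim: j => [//|j IH] Gj; apply: IH; have := EG j.
  rewrite Gj linear0 => /esym/eqP; rewrite scaler_eq0 oppr_eq0 pnatr_eq0.
  by rewrite muln_eq0 addn_eq0 => /eqP.
by rewrite lE (Gv N) ?linear0.
Qed.

(** ker G is disjoint from im E, so its dimension is at most that of ker E; exchanging [E] and [G]
    gives the other inequality. *)
Lemma sl2_dim_ker E H G : sl2_rep E H G -> \dim (lker E) = \dim (lker G).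
Proof.
suff le E' H' G' : sl2_rep E' H' G' -> (\dim (lker G') <= \dim (lker E'))%N.
  by move=> rep; apply/eqP; rewrite eqn_leq (le _ _ _ rep) (le _ _ _ (sl2_rep_sym rep)).
move=> rep; rewrite -(leq_add2r (\dim (limg E'))).
have := limg_ker_dim E' fullv; rewrite capfv => ->.
rewrite -dimv_disjoint_sum ?dimvS ?subvf //.
apply/eqP; rewrite -subv0; apply/subvP=> z; rewrite memv_cap memv_ker memv0.
by case/andP=> /eqP Gz /memv_imgP[u _ zE]; rewrite zE (sl2_imE_kerG rep) -?zE.
Qed.

Lemma sl2_decomp E H G : sl2_rep E H G ->
  directv (limg E + lker G) /\ (limg E + lker G)%VS = fullv.
Proof.
move=> rep.
have dxE : (limg E :&: lker G = 0)%VS.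
  apply/eqP; rewrite -subv0; apply/subvP=> z; rewrite memv_cap memv_ker memv0.
  by case/andP=> /memv_imgP[u _ zE] /eqP Gz; rewrite zE (sl2_imE_kerG rep) -?zE.
split; first exact/directv_addP.
apply/eqP; rewrite eqEdim subvf dimv_disjoint_sum // -(sl2_dim_ker rep).
by rewrite /= -[X in (X <= _)%N](limg_ker_dim E fullv) capfv addnC.
Qed.

Lemma sl2_split E H G z : sl2_rep E H G -> exists u w, G w = 0 /\ z = E u + w.
Proof.
move=> rep; have : z \in (limg E + lker G)%VS by rewrite (proj2 (sl2_decomp rep)) memvf.
case/memv_addP=> _ /memv_imgP[u _ ->] [w]; rewrite memv_ker => /eqP Gw ->.
by exists u, w.
Qed.

Lemma sl2_split_weight E H G z c : sl2_rep E H G -> H z = c *: z ->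
  exists u w, [/\ G w = 0, z = E u + w & H u = (c - 2%:R) *: u].
Proof.
move=> rep Hz; have [v [w [Gw zE]]] := sl2_split z rep.
have [u' [m [Em vE]]] := sl2_split v (sl2_rep_sym rep).
(* Only [E v] matters, so the part of [v] in ker E is dropped; the preimage then lies in im G. *)
exists (G u'), w; have zE' : z = E (G u') + w.
  by rewrite zE vE linearD /= Em addr0.
(* [r] is the weight defect of [u]. First [E r] lies in im E and ker G, hence is zero; then [r] lies
   in im G and ker E, hence is zero. *)
split=> //; set u := G u' in zE' *.
have [dx _] := sl2_decomp rep; have /directv_addP dx0 := dx.
pose r := H u - (c - 2%:R) *: u.
have Er : E r = H (E u) - c *: E u.
  by rewrite (sl2_HE rep) linearB linearZ /= scalerBl opprB addrA.
have Er0 : E r = 0.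
  apply: (sl2_imE_kerG rep); have -> : E r = - (H w - c *: w).
    apply/eqP; rewrite Er -addr_eq0; have : H z - c *: z = 0 by rewrite Hz subrr.
    rewrite zE' linearD scalerDr /= opprD addrACA => <-; exact/eqP.
  have := sl2_kerE_H (sl2_rep_sym rep) Gw; rewrite opp_lfunE linearN /= => GHw.
  by rewrite linearN linearB linearZ /= Gw scaler0 subr0.
have Gr : r = G (H u' - (c : F) *: u').
  rewrite /r /u (sl2_HG rep) scalerBl opprB addrA subrK.
  by rewrite [RHS]linearB [in RHS]linearZ.
apply/eqP; rewrite -subr_eq0 -/r; apply/eqP; rewrite Gr.
by apply: (sl2_imE_kerG (sl2_rep_sym rep)); rewrite -Gr.
Qed.

(** Iterating z = E u + w with w in ker G rewrites z in terms of the vectors E^j w, up to a term in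
    the image of a power of [E] that vanishes. *)
Lemma sl2_generated E H G (U : {vspace V}) : sl2_rep E H G ->
  (forall j w, G w = 0 -> iter j E w \in U) -> U = fullv.
Proof.
move=> rep hU; have [[N EN] _] := sl2_rep_nilpotent rep.
suff imU k z : (k <= N)%N -> iter (N - k) E z \in U.
  apply/vspaceP => z; rewrite memvf; have := imU N z (leqnn N).
  by rewrite subnn.
elim: k z => [|k IH] z kN; first by rewrite subn0 EN mem0v.
have [u [w [Gw ->]]] := sl2_split z rep.
rewrite iter_lfunD -iterSr subnSK //; apply: memvD (IH _ (ltnW kN)) (hU _ _ Gw).
Qed.

(** Applying [G] until it kills leads to a weight [-i] of ker G. Writing weights as [m - N] turns an
    induction on weights into one on the natural number [m]. *)
Lemma sl2_weight_bound E H G : sl2_rep E H G -> exists N : nat,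
  forall c z, H z = c *: z -> z != 0 -> exists m : nat, c = m%:R - N%:R.
Proof.
move=> rep; have [n wG] := sl2_kerG_weight rep.
have [_ [N GN]] := sl2_rep_nilpotent rep.
exists n => c z Hz z0.
have [|j [jz0 Gj]] := nilpotent_last (phi := G) _ z0; first by exists N.
have [|i lt ci] := wG (c - (2 * j)%:R) _ Gj _ jz0.
  by rewrite (sl2_HG_iter rep) Hz iter_lfunZ scalerBl.
exists (2 * j + (n - i))%N; rewrite natrD natrB ?(ltnW lt) // addrAC -addrA.
move/eqP: ci; rewrite subr_eq => /eqP ->; ring.
Qed.

End Sl2.

(** * Nilpotency from eigenvalues and from traces *)

Lemma prod_XsubC_roots0 (F : fieldType) (s : seq F) :
  (forall c, c \in s -> c = 0) -> \prod_(z <- s) ('X - z%:P) = 'X^(size s).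
Proof.
elim: s => [|c s IH] s0; first by rewrite big_nil expr0.
rewrite big_cons (s0 c) ?mem_head // subr0 IH ?exprS // => b bs.
by apply: s0; rewrite inE bs orbT.
Qed.

Lemma mx_eigenvalue0_nilpotent (C : closedFieldType) n (A : 'M[C]_n) :
  (forall a, eigenvalue A a -> a = 0) -> exists k, A ^+ k = 0.
Proof.
case: n A => [|n] A A0; first by exists 1%N; rewrite thinmx0.
have [s cs] := closed_field_poly_normal (char_poly A).
have := monicP (char_poly_monic A) => lc; rewrite lc scale1r in cs.
have s0 c : c \in s -> c = 0.
  by move=> cs'; apply: A0; rewrite eigenvalue_root_char cs root_prod_XsubC.
exists (size s); have := Cayley_Hamilton A; rewrite cs.
by rewrite prod_XsubC_roots0 // rmorphXn /= horner_mx_X.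
Qed.

(** In a full rank factorization [P = X Y], cancelling in [X Y X Y = X Y] gives [Y X = 1], of size
    the rank. *)
Lemma mxtrace_idempotent (F : fieldType) n (P : 'M[F]_n) :
  P *m P = P -> \tr P = (\rank P)%:R.
Proof.
move=> PP; rewrite -{1}(mulmx_base P) mxtrace_mulC.
suff -> : row_base P *m col_base P = 1%:M by rewrite mxtrace1.
have [B' B'C] := row_freeP (row_base_free P).
have [D DC] := row_fullP (col_base_full P).
have CB : col_base P *m row_base P *m (col_base P *m row_base P) = col_base P *m row_base P.
  by rewrite !mulmx_base.
move: CB DC B'C; move: (col_base P) (row_base P) => X Y XY DX YB.
have := congr1 (fun Z => D *m Z *m B') XY.
by rewrite /= !mulmxA DX mul1mx -!mulmxA YB mulmx1.
Qed.

(** Split the characteristic polynomial as [q * 'X^a] with [q] prime to ['X]. The Bezout relation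
    makes [P] the projector onto the part where [A] is invertible; its trace is its rank and also
    zero, so in characteristic 0 that part is trivial. *)
Lemma mx_trace0_nilpotent (C : numClosedFieldType) n (A : 'M[C]_n) :
  (forall j, (0 < j)%N -> \tr (A ^+ j) = 0) -> exists k, A ^+ k = 0.
Proof.
case: n A => [|n] A trA; first by exists 1%N; rewrite thinmx0.
have [a [q]] := multiplicity_XsubC (char_poly A) 0.
rewrite (monic_neq0 (char_poly_monic A)) /= subr0 => rq qE.
exists a.+1; have := Cayley_Hamilton A; rewrite qE => CH.
have /Bezout_eq1_coprimepP[[r s] /= rs] : coprimep ('X^(a.+1)) q.
  by rewrite coprimep_expl // coprimep_sym -['X]subr0 coprimep_XsubC.
pose P := horner_mx A (r * 'X^(a.+1)).
have Pid : P *m P = P.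
  have : P * (1 - P) = 0.
    have -> : 1 - P = horner_mx A (s * q).
      by rewrite /P -(rmorph1 (horner_mx A)) -rmorphB /= -rs addrAC subrr add0r.
    rewrite -rmorphM /= (_ : r * 'X^(a.+1) * (s * q) = r * s * 'X * (q * 'X^a)); last first.
      by rewrite exprS; ring.
    by rewrite [LHS]rmorphM /= CH mulr0.
  by rewrite mulrBr mulr1 => /eqP; rewrite subr_eq0 eq_sym => /eqP.
(* The exponent [a.+1], rather than [a], ensures that only positive powers of [A] occur in [P], even
   for [a = 0]. *)
have trP : \tr P = 0.
  rewrite /P -[r]coefK poly_def mulr_suml rmorph_sum raddf_sum big1 //= => i _.
  rewrite -scalerAl -exprD linearZ /= rmorphXn /= horner_mx_X mxtraceZ trA ?mulr0 //.
  by rewrite addnS.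
have {trP} P0 : P = 0.
  apply/eqP; rewrite -mxrank_eq0 -(pnatr_eq0 C) -mxtrace_idempotent //.
  by rewrite trP.
have : horner_mx A 'X^(a.+1) = P * A ^+ a.+1.
  rewrite -{2}[A](horner_mx_X A) -rmorphXn -rmorphM /=.
  rewrite -{1}['X^(a.+1)]mul1r -rs mulrDl rmorphD /=.
  rewrite (_ : s * q * 'X^(a.+1) = s * 'X * (q * 'X^a)); last by rewrite exprS; ring.
  by rewrite [X in _ + X]rmorphM /= CH mulr0 addr0.
by rewrite P0 mul0r rmorphXn /= horner_mx_X.
Qed.

Section Coordinates.
Variables (F : fieldType) (V : vectType F).
Implicit Types (phi psi : 'End(V)).

Definition lfun_mx phi := passmx.mxof (vbasis {:V}) (vbasis {:V}) phi.

Let bV := vbasisP (fullv : {vspace V}).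

Lemma lfun_mx_comp phi psi : lfun_mx (psi \o phi)%VF = lfun_mx phi *m lfun_mx psi.
Proof. exact: passmx.mxof_comp. Qed.

Lemma lfun_mx_inj : injective lfun_mx.
Proof. exact: can_inj (passmx.mxofK bV bV). Qed.

Lemma lfun_mx_power phi n : lfun_mx (lfun_power phi n) = lfun_mx phi ^+ n.
Proof.
elim: n => [|n IH]; first by rewrite /lfun_mx passmx.mxof1 ?(basis_free bV).
by rewrite /= lfun_mx_comp IH exprSr.
Qed.

Lemma lfun_mx_nilpotent phi : lfun_nilpotent phi <-> exists n, lfun_mx phi ^+ n = 0.
Proof.
split=> -[n hn]; exists n.
  rewrite -lfun_mx_power; have -> : lfun_power phi n = 0.
    by apply/lfunP => z; rewrite lfun_powerE hn zero_lfunE.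
  by rewrite /lfun_mx linear0.
move=> z; rewrite -lfun_powerE (_ : lfun_power phi n = 0) ?zero_lfunE //.
by apply: lfun_mx_inj; rewrite lfun_mx_power hn /lfun_mx linear0.
Qed.

End Coordinates.

Lemma lfun_eigenvalue0_nilpotent (C : closedFieldType) (V : vectType C) (phi : 'End(V)) :
  (forall c z, z != 0 -> phi z = c *: z -> c = 0) -> lfun_nilpotent phi.
Proof.
move=> h; apply/lfun_mx_nilpotent/mx_eigenvalue0_nilpotent => a.
case/eigenvalueP => v va v0; pose b := vbasis (fullv : {vspace V}).
have bb : basis_of fullv b by exact: vbasisP.
apply: (h a (passmx.vecof b v)).
  by rewrite passmx.vecof_eq0 // (basis_free bb).
rewrite -linearZ -va; exact: passmx.hom_vecof.
Qed.

Lemma lfun_trace0_nilpotent (C : numClosedFieldType) (V : vectType C) (phi : 'End(V)) :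
  (forall j, (0 < j)%N -> \tr (lfun_mx phi ^+ j) = 0) -> lfun_nilpotent phi.
Proof. by move=> h; apply/lfun_mx_nilpotent/mx_trace0_nilpotent. Qed.

Lemma mx_nilpotent_trace0 (C : numClosedFieldType) n (A : 'M[C]_n) :
  (exists k, A ^+ k = 0) -> \tr A = 0.
Proof.
case: n A => [|n] A [k Ak]; first by rewrite thinmx0 mxtrace0.
rewrite -[\tr A]opprK -char_poly_trace //.
have [s cs] := closed_field_poly_normal (char_poly A).
have := monicP (char_poly_monic A) => lc; rewrite lc scale1r in cs.
have s0 c : c \in s -> c = 0.
  rewrite -root_prod_XsubC -cs -eigenvalue_root_char => /eigenvalueP[v va v0].
  have vk j : v *m A ^+ j = c ^+ j *: v.
    elim: j => [|j IH]; first by rewrite expr0 scale1r mulmx1.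
    by rewrite exprS mulmxA va -scalemxAl IH scalerA exprS.
  have /eqP := vk k; rewrite Ak mulmx0 eq_sym scaler_eq0 (negPf v0) orbF expf_eq0.
  by case/andP=> _ /eqP.
rewrite cs prod_XsubC_roots0 //.
have := size_char_poly A; rewrite cs size_prod_XsubC => -[->].
by rewrite coefXn eqn_leq ltnn andbF oppr0.
Qed.

(** Among the subspaces on which [P] holds, one of maximal dimension contains every vector
    satisfying [P]. *)
Lemma vspace_of_pred (F : fieldType) (V : vectType F) (P : V -> Prop) :
  P 0 -> (forall a u v, P u -> P v -> P (a *: u + v)) ->
  exists U : {vspace V}, forall v, v \in U <-> P v.
Proof.
move=> P0 Plin.
pose Q n := exists2 U : {vspace V}, \dim U = n & forall v, v \in U -> P v.
have exQ : exists n, `[< Q n >].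
  exists 0%N; apply/asboolP; exists 0%VS; first exact: dimv0.
  by move=> v; rewrite memv0 => /eqP ->.
have bQ n : `[< Q n >] -> (n <= \dim {:V})%N.
  by move=> /asboolP[U <- _]; rewrite dimvS ?subvf.
case: (ex_maxnP exQ bQ) => n /asboolP[U dU UP] nmax.
exists U => v; split=> [|Pv]; first exact: UP.
have : (\dim (U + <[v]>)%VS <= \dim U)%N.
  rewrite dU; apply: nmax; apply/asboolP; exists (U + <[v]>)%VS => //.
  move=> _ /memv_addP[u uU [_ /vlineP[a ->] ->]].
  by rewrite addrC; apply: Plin => //; apply: UP.
rewrite leqNgt => le; suff : (<[v]> <= U)%VS by rewrite -memvE.
apply: contraR le => vU; rewrite ltn_neqAle dimvS ?addvSl // andbT.
apply: contra vU => /eqP dE.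
have -> : U = (U + <[v]>)%VS by apply/eqP; rewrite eqEdim addvSl dE leqnn.
exact: addvSr.
Qed.

(** * Elementary identities in Lie algebras and consequences of semisimplicity *)

Section LieBasics.
Variables (F : fieldType) (g : lieAlgType F).
Implicit Types (x y z : g) (a : F).

Lemma lieDl x y z : [lie x + y, z] = [lie x, z] + [lie y, z].
Proof. by have := lie_linearl z 1 x y; rewrite !scale1r. Qed.

Lemma lie0l z : [lie 0, z] = 0 :> g.
Proof. by apply/eqP; rewrite -(inj_eq (addrI [lie 0, z])) -lieDl !addr0. Qed.

Lemma lieZl a x z : [lie a *: x, z] = a *: [lie x, z].
Proof. by have := lie_linearl z a x 0; rewrite !addr0 lie0l addr0. Qed.

Lemma lieNl x z : [lie - x, z] = - [lie x, z].
Proof. by rewrite -scaleN1r lieZl scaleN1r. Qed.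

Lemma lieDr x y z : [lie x, y + z] = [lie x, y] + [lie x, z].
Proof. exact: linearD. Qed.

Lemma lieZr a x z : [lie x, a *: z] = a *: [lie x, z].
Proof. exact: linearZ. Qed.

Lemma lieNr x z : [lie x, - z] = - [lie x, z].
Proof. exact: linearN. Qed.

Lemma lie0r x : [lie x, 0] = 0 :> g.
Proof. exact: linear0. Qed.

Lemma lieC x y : [lie x, y] = - [lie y, x].
Proof.
apply/eqP; rewrite -addr_eq0; apply/eqP.
by have := liexx (x + y); rewrite lieDl !lieDr !liexx add0r addr0.
Qed.

Lemma lieA x y z : [lie x, [lie y, z]] = [lie [lie x, y], z] + [lie y, [lie x, z]].
Proof.
have := lie_jacobi x y z; rewrite (lieC z [lie x, y]) (lieC z x) lieNr.
by move/eqP; rewrite -addrA addr_eq0 -opprD opprK => /eqP ->; rewrite addrC.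
Qed.

Lemma adE x y : ad x y = [lie x, y].
Proof. by rewrite lfunE. Qed.

Lemma semisimple_abelian_ideal (I : {vspace g}) : lie_semisimple g ->
  lie_ideal I -> (forall x y, x \in I -> y \in I -> [lie x, y] = 0) -> I = 0%VS.
Proof.
move=> ss idI abI; apply: ss => //; exists 1%N; apply/eqP; rewrite -subv0.
apply/span_subvP => _ /allpairsP[[x y] /= [xI yI ->]].
by rewrite abI ?mem0v // vbasis_mem.
Qed.

Lemma semisimple_center x : lie_semisimple g -> (forall y, [lie x, y] = 0) -> x = 0.
Proof.
move=> ss xc; apply/eqP; rewrite -memv0 -(@semisimple_abelian_ideal <[x]>%VS) ?memv_line //.
  by move=> y _ /vlineP[a ->]; rewrite lieZr lieC xc oppr0 scaler0 mem0v.
by move=> _ z /vlineP[a ->] _; rewrite lieZl xc scaler0.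
Qed.

End LieBasics.

Lemma sl2_triple_rep (F : numFieldType) (g : lieAlgType F) (e h f : g) :
  sl2_triple e h f -> sl2_rep (ad e) (ad h) (ad f).
Proof.
case=> he hf ef; split=> z; rewrite !adE lieA ?he ?hf ?ef addrC ?lieZl //.
by rewrite scaleNr.
Qed.

(** * Nilpotent derivations of square zero *)

Section Derivation.
Variables (F : numFieldType) (g : lieAlgType F) (D : 'End(g)).
Implicit Types (s u v : seq g) (w x y z : g).
Hypothesis derD : forall x y, D [lie x, y] = [lie D x, y] + [lie x, D y].
Hypothesis sqD : forall x, D (D x) = 0.

Definition adw s w := foldr (fun x z => [lie x, z]) w s.

Lemma adw_cat s u w : adw (s ++ u) w = adw s (adw u w).
Proof. exact: foldr_cat. Qed.

Lemma adwD s w z : adw s (w + z) = adw s w + adw s z.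
Proof. by elim: s => //= x s ->; rewrite lieDr. Qed.

Lemma adw0 s : adw s 0 = 0.
Proof. by elim: s => //= x s ->; rewrite lie0r. Qed.

Lemma adwN s w : adw s (- w) = - adw s w.
Proof. by elim: s => //= x s ->; rewrite lieNr. Qed.

(** Both terms of [D (D [lie x, w]) = 0] equal [[lie D x, D w]], which is therefore zero. *)
Lemma derivation_sandwich x w : D [lie x, D w] = 0.
Proof.
have e1 : D [lie D x, w] = [lie D x, D w] by rewrite derD sqD lie0l add0r.
have e2 : D [lie x, D w] = [lie D x, D w] by rewrite derD sqD lie0r addr0.
have := sqD [lie x, w]; rewrite derD linearD /= e1 e2 -mulr2n -scaler_nat.
by move/eqP; rewrite scaler_eq0 pnatr_eq0 => /eqP.
Qed.

Section Step.
Variable n : nat.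
Hypothesis short : forall s w, (size s < n)%N -> D (adw s (D w)) = 0.

(** By Jacobi, swapping two neighbours costs a word with one letter less, killed by [short]. *)
Lemma word_swap s x y u w : size (s ++ x :: y :: u) = n ->
  D (adw (s ++ x :: y :: u) (D w)) = D (adw (s ++ y :: x :: u) (D w)).
Proof.
rewrite size_cat /= => sz; rewrite !adw_cat /= lieA adwD linearD /=.
have := @short (s ++ [lie x, y] :: u) w; rewrite adw_cat /= => ->; first by rewrite add0r.
by rewrite size_cat /= -sz; lia.
Qed.

Lemma word_front v t x u w : size (v ++ t ++ x :: u) = n ->
  D (adw (v ++ t ++ x :: u) (D w)) = D (adw (v ++ x :: t ++ u) (D w)).
Proof.
elim/last_ind: t u => [//|t y IH] u; rewrite !cat_rcons => sz.
rewrite catA word_swap -?catA // IH //.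
by move: sz; rewrite !size_cat /=; lia.
Qed.

Lemma word_perm v s t w : perm_eq s t -> size (v ++ s) = n ->
  D (adw (v ++ s) (D w)) = D (adw (v ++ t) (D w)).
Proof.
elim: s t v => [|x s IH] t v st sz.
  by have /perm_size/esym/size0nil -> := st.
have xt : x \in t by rewrite -(perm_mem st) mem_head.
case/splitPr: xt st => t1 t2 st.
rewrite word_front; last by rewrite size_cat -(perm_size st) -size_cat.
rewrite -[v ++ x :: s]cat_rcons -[v ++ x :: _]cat_rcons; apply: IH.
  rewrite -(perm_cons x); apply: perm_trans st _.
  by rewrite -[x :: t2]cat1s perm_catCA.
by rewrite cat_rcons.
Qed.

(* [x1, [.. [xm, D]]], as an endomorphism of g. *)
Fixpoint br s w := if s is x :: s' then [lie x, br s' w] - br s' [lie x, w] else D w.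

(** Already [x, D] is inner, equal to ad (- D x); further brackets stay inner. *)
Lemma br_ad s : (0 < size s)%N -> exists t, forall w, br s w = [lie t, w].
Proof.
elim: s => [//|x [|y s] IH] _.
  by exists (- D x) => w; rewrite /= derD lieNl opprD addrCA subrr addr0.
have [//|t ht] := IH; exists [lie x, t] => w; rewrite [LHS]/= -/(br (y :: s) w) -/(br (y :: s) _).
by rewrite !ht lieA addrK.
Qed.

Lemma D_adw_br u s w :
  ((size u + size s < n)%N -> D (adw u (br s w)) = 0) /\
  (size u + size s = n -> D (adw u (br s w)) = D (adw (u ++ s) (D w))).
Proof.
elim: s u w => [|x s IH] u w /=; first by rewrite addn0 cats0; split=> // /short.
have [IH1 IH2] := IH (rcons u x) w; have [IH3 _] := IH u [lie x, w].
move: IH1 IH2; rewrite size_rcons addSnnS -cats1 adw_cat /= -catA /= => IH1 IH2.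
rewrite adwD adwN linearB /=; split=> sz.
  by rewrite IH1; [rewrite IH3 ?subr0 //; lia | lia].
by rewrite IH2; [rewrite IH3 ?subr0 //; lia | lia].
Qed.

(** When the iterated commutators are expanded, a term with fewer than [n] letters between the two
    factors [D] vanishes by [short]. At total length [n] only the term with all letters between them
    survives; the sign counts the letters of [s] moved across [D]. *)
Lemma br_adw_br s v s' w :
  ((size s + size v + size s' < n)%N -> br s (adw v (br s' w)) = 0) /\
  (size s + size v + size s' = n ->
     br s (adw v (br s' w)) = (-1) ^+ size s *: D (adw (rev s ++ v ++ s') (D w))).
Proof.
elim: s v => [|x s IH] v /=.
  by rewrite add0n scale1r; apply: D_adw_br.
have [IH1 _] := IH v; have [IH2 IH3] := IH (x :: v).
split=> sz; first by rewrite IH1 ?IH2 ?lie0r ?subrr //=; lia.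
rewrite IH1 ?lie0r ?sub0r; last by lia.
rewrite IH3 /=; last by lia.
by rewrite rev_cons cat_rcons exprS mulN1r scaleNr.
Qed.

(** Write the commutators of [D] with [s] and [s'] as ad t and ad t'. Then (ad t)(ad t') and (ad
    t')(ad t) vanish, whereas t x t' and t' x t both send [w] to the same multiple, by a sign, of
    [W]. Expanding [t, [[x, t'], w]] by Jacobi makes these two terms opposite, so [2 W = 0]. *)
Lemma word_odd s x s' w : size s = size s' -> (0 < size s)%N ->
  (size s + size s').+1 = n -> D (adw (rev s ++ x :: s') (D w)) = 0.
Proof.
move=> ss' s_gt0 sz; set W := D _.
have [t ht] := br_ad s_gt0; have [t' ht'] : exists t', forall z, br s' z = [lie t', z].
  by apply: br_ad; rewrite -ss'.
have tt' z : [lie t, [lie t', z]] = 0.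
  by rewrite -ht -ht'; apply: (proj1 (br_adw_br s [::] s' z)) => /=; lia.
have t't z : [lie t', [lie t, z]] = 0.
  by rewrite -ht -ht'; apply: (proj1 (br_adw_br s' [::] s z)) => /=; lia.
have txt' : [lie t, [lie x, [lie t', w]]] = (-1) ^+ size s *: W.
  by rewrite -ht -ht'; apply: (proj2 (br_adw_br s [:: x] s' w)) => /=; lia.
have t'xt : [lie t', [lie x, [lie t, w]]] = (-1) ^+ size s *: W.
  rewrite -ht -ht' ss'; have := proj2 (br_adw_br s' [:: x] s w) => /= ->; last by lia.
  congr (_ *: _); apply: (@word_perm [::]) => /=; last first.
    by rewrite size_cat size_rev /=; lia.
  by apply/permP => a; rewrite !count_cat /= !count_rev; lia.
have := lieA t [lie x, t'] w; rewrite (lieC x t') lieNr tt' oppr0 lie0l add0r -lieC.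
move=> /eqP; rewrite -subr_eq0.
have xt' z : [lie [lie x, t'], z] = [lie x, [lie t', z]] - [lie t', [lie x, z]].
  by rewrite (lieA x t') addrK.
rewrite !xt' lieDr lieNr tt' t't lie0r t'xt txt' subr0 sub0r opprK -scalerDl.
by rewrite -mulr2n scaler_eq0 mulrn_eq0 /= signr_eq0 => /eqP.
Qed.

End Step.

Variables (k p : {vspace g}).
Hypothesis kp : forall x, exists y z, [/\ y \in k, z \in p & x = y + z].
Hypothesis pk : forall x y, x \in p -> y \in k -> [lie x, y] \in p.
Hypothesis pp : forall x y, x \in p -> y \in p -> [lie x, y] \in k.
Hypothesis Dk : forall x, x \in k -> D x = 0.
Hypothesis Dp : forall x, x \in p -> D x \in k.

Lemma adw_parity s w : all [in p] s -> w \in k ->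
  if odd (size s) then adw s w \in p else adw s w \in k.
Proof.
elim: s => //= x s IH /andP[xp sp] wk; move: (IH sp wk).
by case: odd => /= h; [apply: pp | apply: pk].
Qed.

(** Induction on the length. With all letters in p, an even word maps the image of [D] into k, which
    [D] kills; an odd word is cut at its middle letter for [word_odd], length one being the sandwich
    identity. *)
Lemma word_zero s w : D (adw s (D w)) = 0.
Proof.
have [n] := ubnP (size s); elim: n s w => // n IH s w; rewrite ltnS => sn.
have short u z : (size u < size s)%N -> D (adw u (D z)) = 0.
  by move=> us; apply: IH; apply: leq_trans us sn.
have inp u : size u = size s -> all [in p] u -> D (adw u (D w)) = 0.
  move=> us up; case odd_u: (odd (size u)); last first.
    have [y [z [yk zp ->]]] := kp w; rewrite linearD /= (Dk yk) add0r.
    by have := adw_parity up (Dp zp); rewrite odd_u; apply: Dk.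
  case m0: (size u)./2 => [|m].
    move: (odd_double_half (size u)); rewrite odd_u m0 /=.
    by case: u {us up odd_u m0} => [|x []] //= _; apply: derivation_sandwich.
  pose a := rev (take m.+1 u); pose b := drop m.+1 u.
  have su : size u = (m.+1 + m.+1).+1.
    by rewrite -(odd_double_half (size u)) odd_u m0 -addnn.
  have : size b = m.+2 by rewrite size_drop su; lia.
  have uE : u = rev a ++ b by rewrite revK cat_take_drop.
  have sa : size a = m.+1 by rewrite size_rev size_takel // su; lia.
  move: uE; case: b => // x b -> [sb]; apply: (word_odd short).
  - by rewrite sa sb.
  - by rewrite sa.
  - by rewrite sa sb -us su.
(* Letters are split into components in k and p one at a time. A letter from k can be moved to the
   front, where [D] commutes with its bracket and leaves a shorter word. *)
suff gen t u : size (t ++ u) = size s -> all [in p] u -> D (adw (t ++ u) (D w)) = 0.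
  by have := gen s [::]; rewrite cats0; apply.
elim/last_ind: t u => [|t x IHt] u; first exact: inp.
rewrite cat_rcons => sz up; have [y [z [yk zp xE]]] := kp x.
have -> : adw (t ++ x :: u) (D w) = adw (t ++ y :: u) (D w) + adw (t ++ z :: u) (D w).
  by rewrite !adw_cat /= xE lieDl adwD.
rewrite linearD /= [X in _ + X]IHt ?addr0 /= ?zp //; last by rewrite -sz !size_cat.
have sz' : size (t ++ y :: u) = size s by rewrite -sz !size_cat.
rewrite -[t ++ _]cat0s (word_front short) //= derD (Dk yk) lie0l add0r.
by rewrite short ?lie0r // -sz' !size_cat /=; lia.
Qed.

(** [I] is the largest ideal inside ker D, and it contains im D by [word_zero]. For w in [I], both
    [D w] and [D [lie x, w]] vanish, so im D centralizes [I]. Hence im D lies in the abelian ideal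
    [Z], which is zero. *)
Lemma semisimple_derivation0 : lie_semisimple g -> D = 0.
Proof.
move=> ss; have [|a u v Iu Iv|I hI] := @vspace_of_pred _ _ (fun w => forall s, D (adw s w) = 0).
- by move=> s; rewrite adw0 linear0.
- move=> s; rewrite adwD linearD /= Iv addr0.
  by rewrite (_ : adw s _ = a *: adw s u) ?linearZ /= ?Iu ?scaler0 //; elim: s => //= x s ->; rewrite lieZr.
have idI : lie_ideal I.
  by move=> x y /hI yI; apply/hI => s; have := yI (rcons s x); rewrite -cats1 adw_cat.
pose Q z := z \in I /\ forall w, w \in I -> [lie z, w] = 0.
have [|a u v [uI Qu] [vI Qv]|Z hZ] := @vspace_of_pred _ _ Q.
- by split; [exact: mem0v | move=> w _; rewrite lie0l].
- by split; [rewrite memvD ?memvZ | move=> w wI; rewrite lieDl lieZl Qu ?Qv ?scaler0 ?addr0].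
have Z0 : Z = 0%VS.
  apply: semisimple_abelian_ideal => // [x z /hZ[zI zc]|x y /hZ[xI xc] /hZ[yI _]].
    apply/hZ; split=> [|w wI]; first exact: idI.
    have /eqP := lieA x z w; rewrite zc // lie0r eq_sym addr_eq0 => /eqP ->.
    by rewrite zc ?oppr0 //; apply: idI.
  exact: xc.
apply/lfunP => x; apply/eqP; rewrite zero_lfunE -memv0 -Z0; apply/hZ; split.
  by apply/hI => s; apply: word_zero.
move=> w /hI wI; have := wI [:: x]; have := wI [::]; rewrite /= => Dw.
by rewrite derD Dw lie0r addr0.
Qed.

End Derivation.

(** * The decomposition g = k + p *)

Section SymmetricPair.
Variables (F : numFieldType) (g : lieAlgType F) (theta : 'End(g)).
Implicit Types (x y z : g).
Hypothesis thetaM : forall x y, theta [lie x, y] = [lie theta x, theta y].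
Hypothesis thetaK : forall x, theta (theta x) = x.

Let k := fixedSpace theta.
Let p := leigenspace theta (-1).

Lemma mem_k x : (x \in k) = (theta x == x).
Proof. exact/fixedSpaceP/eqP. Qed.

Lemma mem_p x : (x \in p) = (theta x == - x).
Proof.
rewrite memv_ker add_lfunE opp_lfunE scale_lfunE id_lfunE scaleN1r opprK.
by rewrite addr_eq0.
Qed.

Lemma theta_sym_k x : x + theta x \in k.
Proof. by rewrite mem_k linearD /= thetaK addrC. Qed.

Lemma theta_antisym_p x : x - theta x \in p.
Proof. by rewrite mem_p linearB /= thetaK opprB. Qed.

Lemma kp_split x : exists y z, [/\ y \in k, z \in p & x = y + z].
Proof.
exists (2%:R^-1 *: (x + theta x)), (2%:R^-1 *: (x - theta x)).
split; rewrite ?memvZ ?theta_sym_k ?theta_antisym_p // -scalerDr addrACA subrr addr0.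
by rewrite -mulr2n -[x *+ 2]scaler_nat scalerA mulVf ?scale1r ?pnatr_eq0.
Qed.

Lemma kp_disjoint x : x \in k -> x \in p -> x = 0.
Proof.
rewrite mem_k mem_p => /eqP -> /eqP/(congr1 (+%R x)); rewrite subrr -mulr2n => /eqP.
by rewrite -scaler_nat scaler_eq0 pnatr_eq0 => /eqP.
Qed.

Lemma lie_kk x y : x \in k -> y \in k -> [lie x, y] \in k.
Proof. by rewrite !mem_k thetaM => /eqP -> /eqP ->. Qed.

Lemma lie_kp x y : x \in k -> y \in p -> [lie x, y] \in p.
Proof. by rewrite mem_k !mem_p thetaM => /eqP -> /eqP ->; rewrite lieNr. Qed.

Lemma lie_pk x y : x \in p -> y \in k -> [lie x, y] \in p.
Proof. by rewrite mem_k !mem_p thetaM => /eqP -> /eqP ->; rewrite lieNl. Qed.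

Lemma lie_pp x y : x \in p -> y \in p -> [lie x, y] \in k.
Proof. by rewrite mem_k !mem_p thetaM => /eqP -> /eqP ->; rewrite lieNl lieNr opprK. Qed.

(* An automorphism preserving k commutes with theta: its commutator with theta
   is 1 + D, where D is a derivation which kills k and maps p to k. *)
Lemma automorphism_preserves_p (phi : 'End(g)) : lie_semisimple g ->
  lie_automorphism phi -> (forall x, x \in k -> phi x \in k) ->
  forall x, x \in p -> phi x \in p.
Proof.
move=> ss [/eqP inj phiM] phik.
have phiK := lker0_lfunK inj; have phiVK := lker0_lfunVK inj.
have phiVM x y : phi^-1%VF [lie x, y] = [lie phi^-1%VF x, phi^-1%VF y].
  by rewrite -{1}(phiVK x) -{1}(phiVK y) -phiM phiK.
have phi_k x : phi x \in k -> x \in k.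
  have kE : k = (phi @: k)%VS.
    apply/eqP; rewrite eq_sym eqEdim limg_dim_eq ?leqnn ?andbT.
      by apply/subvP => _ /memv_imgP[y yk ->]; apply: phik.
    by rewrite (eqP inj) capv0.
  by rewrite {1}kE => /memv_imgP[y yk /(congr1 phi^-1%VF)]; rewrite !phiK => ->.
pose al := (phi \o theta \o phi^-1 \o theta)%VF.
have alE x : al x = phi (theta (phi^-1%VF (theta x))) by rewrite !comp_lfunE.
have alM x y : al [lie x, y] = [lie al x, al y].
  by rewrite !alE thetaM phiVM thetaM phiM.
pose D := al - \1%VF; have DE x : D x = al x - x.
  by rewrite add_lfunE opp_lfunE id_lfunE.
have Dk x : x \in k -> D x = 0.
  rewrite DE alE => xk; have := xk; rewrite mem_k => /eqP ->.
  have : phi^-1%VF x \in k by apply: phi_k; rewrite phiVK.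
  by rewrite mem_k => /eqP ->; rewrite phiVK subrr.
have Dp x : x \in p -> D x \in k.
  rewrite mem_p => /eqP xp; set w := phi^-1%VF x.
  have -> : D x = - phi (w + theta w).
    by rewrite DE alE xp !linearN linearD /= phiVK opprD addrC.
  by rewrite memvN; apply/phik/theta_sym_k.
have Dz x : D x \in k.
  have [y [z [yk zp ->]]] := kp_split x.
  by rewrite linearD /= Dk // add0r Dp.
have DD x y : D [lie x, y] = [lie D x, y] + [lie x, D y] + [lie D x, D y].
  have aE z : al z = z + D z by rewrite DE addrC subrK.
  rewrite DE alM !aE lieDl !lieDr addrAC [[lie x, y] + _]addrC addrK addrA.
  by rewrite [[lie x, D y] + _]addrC.
(* The quadratic term is what separates [al - 1] from a derivation. It lies in k since im D does,
   and in p since [D] kills [x, y]; so it is zero. *)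
have DDp x y : x \in p -> y \in p -> [lie D x, D y] = 0.
  move=> xp yp; apply: kp_disjoint; first exact: lie_kk (Dz _) (Dz _).
  have := DD x y; rewrite Dk ?lie_pp // => /esym/eqP; rewrite addrC addr_eq0 => /eqP ->.
  by rewrite memvN memvD ?(lie_kp (Dz x)) // lie_pk.
have derD x y : D [lie x, y] = [lie D x, y] + [lie x, D y].
  rewrite DD; have -> : [lie D x, D y] = 0; last by rewrite addr0.
  have [x1 [x2 [x1k x2p ->]]] := kp_split x; have [y1 [y2 [y1k y2p ->]]] := kp_split y.
  by rewrite !linearD /= (Dk x1) // (Dk y1) // !add0r lie0r add0r DDp.
have D0 : D = 0.
  by apply: (semisimple_derivation0 derD _ kp_split lie_pk lie_pp) => // x; rewrite Dk.
have al1 x : al x = x by apply/eqP; rewrite -subr_eq0 -DE D0 zero_lfunE.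
move=> x xp; rewrite mem_p; have := al1 (theta (phi x)); rewrite alE thetaK phiK.
by move: xp; rewrite mem_p => /eqP ->; rewrite linearN => ->.
Qed.

(** * The triple and the slice e + g^f *)

Section Triple.
Variables e h f : g.
Hypothesis tr : sl2_triple e h f.
Hypotheses (ep : e \in p) (fp : f \in p).

Let rep := sl2_triple_rep tr.

Lemma ad_eigenspaceP (d : int) x :
  reflect ([lie h, x] = d%:~R *: x) (x \in ad_eigenspace h d).
Proof.
rewrite memv_ker add_lfunE opp_lfunE scale_lfunE id_lfunE adE subr_eq0.
exact: eqP.
Qed.

(** The hypothesis is the injectivity of ad e on g_0 /\ p; that of ad f on g_2 /\ k holds because
    all weights on ker (ad f) are at most 0. *)
Lemma triple_dim_eq :
  (forall x, x \in p -> [lie h, x] = 0 -> [lie e, x] = 0 -> x = 0) ->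
  \dim (ad_eigenspace h 0 :&: p) = \dim (ad_eigenspace h 2 :&: k).
Proof.
move=> cent0; case: (tr) => he hf ef.
apply/eqP; rewrite eqn_leq; apply/andP; split.
  rewrite -(limg_dim_eq (f := ad e)).
    apply: dimvS; apply/subvP => _ /memv_imgP[x xU ->]; move: xU.
    case/memv_capP=> /ad_eigenspaceP hx xp; rewrite adE; apply/memv_capP; split; last exact: lie_pp.
    by apply/ad_eigenspaceP; rewrite lieA he hx scale0r lie0r addr0 lieZl.
  apply/eqP; rewrite -subv0; apply/subvP => x; rewrite !memv_cap (memv_ker (ad e)) adE memv0.
  case/andP=> /andP[/ad_eigenspaceP hx xp] /eqP ex; apply/eqP/cent0 => //.
  by rewrite hx scale0r.
rewrite -(limg_dim_eq (f := ad f)).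
  apply: dimvS; apply/subvP => _ /memv_imgP[x xU ->]; move: xU.
  case/memv_capP=> /ad_eigenspaceP hx xk; rewrite adE; apply/memv_capP; split; last exact: lie_pk.
  apply/ad_eigenspaceP; rewrite lieA hf hx scale0r lieZr scaleNr lieNl lieZl.
  by rewrite addrC subrr.
apply/eqP; rewrite -subv0; apply/subvP => x; rewrite !memv_cap (memv_ker (ad f)) memv0.
case/andP=> /andP[/ad_eigenspaceP hx _] /eqP fx; apply: contraT => x0.
have [n hn] := sl2_kerG_weight rep.
have [|i _ /eqP] := hn 2%:R x fx _ x0; first by rewrite adE hx.
by rewrite -addr_eq0 -natrD pnatr_eq0.
Qed.

(** Ascending induction on the weight. A vector of weight c is [e, v] + w with v of weight c - 2 and
    w in g^f. Replacing e by e + u costs [u, v], whose components have weight at most c - 2, since u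
    has only weights at most 0. *)
Lemma slice_transversal u : [lie f, u] = 0 ->
  (limg (ad (e + u)%R) + lker (ad f))%VS = fullv.
Proof.
move=> fu; set W := (_ + _)%VS.
have kerf_h z : z \in lker (ad f) -> ad h z \in lker (ad f).
  rewrite !memv_ker => /eqP fz; have := sl2_kerE_H (sl2_rep_sym rep) fz.
  by rewrite opp_lfunE linearN => /eqP; rewrite oppr_eq0.
have [X bX hX] := sl2_kerG_eigenbasis rep (subvv _) kerf_h.
have span_X (Q : g -> Prop) : Q 0 -> (forall a u v, Q u -> Q v -> Q (a *: u + v)) ->
    (forall x, x \in X -> Q x) -> forall z, [lie f, z] = 0 -> Q z.
  move=> Q0 Qlin QX z fz; have [U hU] := vspace_of_pred Q0 Qlin.
  apply/hU; suff : (lker (ad f) <= U)%VS by move/subvP; apply; rewrite memv_ker adE fz.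
  by rewrite -(span_basis bX); apply/span_subvP => x /QX /hU.
have [N wN] := sl2_weight_bound rep.
have Wlow m c z : c = m%:R - N%:R -> [lie h, z] = c *: z -> z \in W.
  have [n] := ubnP m; elim: n m c z => // n IH m c z; rewrite ltnS => mn cE hz.
  have [v [w [fw zE hv]]] := sl2_split_weight rep (etrans (adE _ _) hz).
  have -> : z = [lie e + u, v] + w - [lie u, v].
    by rewrite zE adE lieDl addrAC addrK.
  apply: memvB; first by apply: memv_add; rewrite ?memv_ker ?fw // -adE memv_img ?memvf.
  move: fu; apply: (@span_X (fun u => [lie u, v] \in W)).
  - by rewrite lie0l mem0v.
  - by move=> a y y' yW y'W; rewrite lieDl lieZl memvD ?memvZ.
  move=> x /hX[d hx]; have [-> |xv0] := eqVneq [lie x, v] 0; first exact: mem0v.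
  have hxv : ad h [lie x, v] = (c - 2%:R - d%:R) *: [lie x, v].
    rewrite adE lieA -!adE hx hv !adE lieZl lieZr -scalerDl; congr (_ *: _); ring.
  have [m' m'E] := wN _ _ hxv xv0.
  apply: (IH m' _ _ _ m'E); last by rewrite -adE hxv.
  apply: leq_trans mn; rewrite -(ltr_nat F) -(ltrD2r (- N%:R)) -m'E -cE -addrA.
  by rewrite gtrDl -opprD oppr_lt0 -natrD ltr0n.
apply: (sl2_generated rep) => j w; rewrite adE.
apply: (@span_X (fun w => iter j (ad e) w \in W)).
- by rewrite iter_lfun0 mem0v.
- by move=> a y y' yW y'W; rewrite iter_lfunD iter_lfunZ memvD ?memvZ.
move=> x /hX[d hx]; have [-> |xv0] := eqVneq (iter j (ad e) x) 0; first exact: mem0v.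
have hjx := sl2_HE_iter rep j x; rewrite hx iter_lfunZ -scalerDl in hjx.
have [m mE] := wN _ _ hjx xv0.
by apply: (Wlow m _ _ mE); rewrite -adE hjx.
Qed.

(** The centralizers of e and y = e + u have the same dimension, so g is the direct sum of [y, g]
    and g^f. As [phi h, y] = 2 y, the vector 2 u - [h, u] = [y, h - phi h] lies in both summands;
    thus u would have weight 2 in g^f, whose weights are at most 0. *)
Lemma slice_orbit (phi : 'End(g)) u : lie_automorphism phi ->
  [lie f, u] = 0 -> phi e = e + u -> u = 0.
Proof.
move=> [inj phiM] fu phie; set y := e + u in phie *.
have kerE : lker (ad y) = (phi @: lker (ad e))%VS.
  have /eqP phi0 := inj; have phiVK := lker0_lfunVK phi0.
  apply/vspaceP => z; rewrite memv_ker adE; apply/eqP/memv_imgP => [yz|[v ve ->]].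
    exists (phi^-1%VF z); last by rewrite phiVK.
    rewrite memv_ker adE -memv0 -(eqP phi0) memv_ker phiM phie phiVK yz.
    by rewrite eqxx.
  by rewrite -phie -phiM; move: ve; rewrite memv_ker adE => /eqP ->; rewrite linear0.
have dimy : (\dim (limg (ad y)) + \dim (lker (ad f)) = \dim {:g})%N.
  rewrite -(sl2_dim_ker rep) addnC -(limg_ker_dim (ad y) fullv) capfv kerE.
  by rewrite [\dim (phi @: _)]limg_dim_eq // inj capv0.
have cap0 : (limg (ad y) :&: lker (ad f))%VS = 0%VS.
  apply/eqP; rewrite -dimv_eq0 -(eqn_add2l (\dim (limg (ad y) + lker (ad f)))).
  by rewrite dimv_sum_cap dimy slice_transversal // addn0.
case: (tr) => he _ _.
have phihy : [lie phi h, y] = 2%:R *: y by rewrite -phie -phiM he linearZ.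
have fhu : [lie f, [lie h, u]] = 0.
  have := sl2_kerE_H (sl2_rep_sym rep) (etrans (adE _ _) fu).
  by rewrite opp_lfunE linearN /= !adE => /eqP; rewrite oppr_eq0 => /eqP.
have hu : [lie h, u] = 2%:R *: u.
  have yh : ad y (h - phi h) = 2%:R *: u - [lie h, u].
    rewrite adE lieC lieDl lieNl phihy /y lieDr he scalerDr opprB opprD.
    by rewrite addrACA subrr add0r.
  apply/eqP; rewrite eq_sym -subr_eq0 -memv0 -cap0 memv_cap memv_ker -{1}yh.
  by rewrite memv_img ?memvf //= adE lieDr lieNr lieZr fu fhu scaler0 subr0.
apply/eqP; apply: contraT => u0; have [n hn] := sl2_kerG_weight rep.
have [||i _ /eqP] := hn 2%:R u _ _ u0; [by rewrite adE | by rewrite adE hu |].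
by rewrite -addr_eq0 -natrD pnatr_eq0.
Qed.

(** This is the p-part of the decomposition of g at e + x: averaging with theta projects v to k and
    w to p. *)
Lemma centralizer_transversal x : x \in p -> [lie x, e] = 0 -> [lie x, f] = 0 ->
  forall t, t \in p -> exists v b, [/\ v \in k, b \in p, [lie f, b] = 0 &
    t = [lie v, e + x] + b].
Proof.
move=> xp xe xf t tp; have fx : [lie f, x] = 0 by rewrite lieC xf oppr0.
have := memvf t; rewrite -(slice_transversal fx) => /memv_addP[_ /memv_imgP[v _ ->]].
case=> w; rewrite memv_ker adE => /eqP fw tE.
exists (- (2%:R^-1 *: (v + theta v))), (2%:R^-1 *: (w - theta w)).
have yp : theta (e + x) = - (e + x) by apply/eqP; rewrite -mem_p memvD.
split; rewrite ?memvN ?memvZ ?theta_sym_k ?theta_antisym_p //.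
  have /eqP tf : theta f == - f by rewrite -mem_p.
  rewrite lieZr lieDr lieNr fw -[f]opprK -tf lieNl -thetaM fw linear0.
  by rewrite opprK addr0 scaler0.
rewrite lieNl -lieC lieZr -scalerDr lieDr.
have -> : [lie e + x, theta v] = - theta [lie e + x, v].
  by rewrite thetaM yp lieNl opprK.
rewrite addrACA -opprD -linearD -(adE (e + x)) -tE.
move: tp; rewrite mem_p /= => /eqP ->.
by rewrite opprK -mulr2n -[t *+ 2]scaler_nat scalerA mulVf ?scale1r ?pnatr_eq0.
Qed.

End Triple.

End SymmetricPair.

(** An eigenvector of ad x for some c != 0 is lowered by ad f, which commutes with ad x, to w in
    g^f. On the c-eigenspace ad (e + x) is c plus a nilpotent map, so w = [e + x, v].
    Antisymmetrizing gives w - theta w, nonzero because theta w has eigenvalue -c. *)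
Lemma nonnilpotent_slice_direction (C : numClosedFieldType) (g : lieAlgType C)
    (theta : 'End(g)) (e h f x : g) :
  (forall x y, theta [lie x, y] = [lie theta x, theta y]) ->
  (forall x, theta (theta x) = x) -> sl2_triple e h f ->
  theta e = - e -> theta f = - f -> theta x = - x ->
  [lie x, e] = 0 -> [lie x, f] = 0 -> ~ lfun_nilpotent (ad x) ->
  exists v, [/\ theta v = v, [lie f, [lie v, e + x]] = 0 & [lie v, e + x] != 0].
Proof.
move=> thetaM thetaK tr te tf tx xe xf nnil.
have [[N EN] [M GM]] := sl2_rep_nilpotent (sl2_triple_rep tr).
have [c [z [c0 z0 xz]]] : exists c z, [/\ c != 0, z != 0 & ad x z = c *: z].
  apply: contrapT => no; apply: nnil; apply: lfun_eigenvalue0_nilpotent => c z z0 xz.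
  by apply/eqP; apply: contraT => c0; case: no; exists c, z.
have [|j [w0 fw]] := nilpotent_last (phi := ad f) _ z0; first by exists M.
set w := iter j (ad f) z in w0 fw.
have xw : [lie x, w] = c *: w.
  rewrite -adE /w -iter_lfun_comm ?xz ?iter_lfunZ // => y.
  by rewrite !adE lieA (lieC f x) xf oppr0 lie0l add0r.
rewrite adE in fw.
have solve n u : iter n (ad e) u = 0 -> [lie x, u] = c *: u -> exists v, [lie e + x, v] = u.
  elim: n u => [|n IH] u; first by move=> /= -> _; exists 0; rewrite lie0r.
  rewrite iterSr adE => eu xu; have [|v hv] := IH _ eu.
    by rewrite lieA xe lie0l add0r xu lieZr.
  exists (c^-1 *: (u - v)); rewrite lieZr lieDr lieNr hv lieDl xu.
  by rewrite addrAC subrr add0r scalerA mulVf ?scale1r.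
have [v hv] := solve N w (EN w) xw.
have ty : theta (e + x) = - (e + x) by rewrite linearD /= te tx opprD.
have vE : [lie - (v + theta v), e + x] = w - theta w.
  rewrite lieNl -lieC lieDr hv -[e + x in X in _ + X]opprK -ty lieNl -thetaM hv.
  by [].
exists (- (v + theta v)); split.
- by rewrite linearN linearD /= thetaK addrC.
- by rewrite vE lieDr lieNr fw -[f]opprK -tf lieNl -thetaM fw linear0 !oppr0 addr0.
rewrite vE subr_eq0; apply: contra w0 => /eqP wt.
have : [lie x, theta w] = - (c *: theta w).
  by rewrite -[x]opprK -tx lieNl -thetaM xw linearZ.
rewrite -wt xw => /eqP; rewrite -addr_eq0 -mulr2n -scaler_nat !scaler_eq0.
by rewrite pnatr_eq0 (negPf c0).
Qed.

(** * Noetherian rings *)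

Section Ideals.
Variable R : comNzRingType.
Implicit Types (J : R -> Prop) (l : seq R) (x y r : R).

Definition is_ideal J := [/\ J 0, forall x y, J x -> J y -> J (x + y) &
  forall r x, J x -> J (r * x)].

Lemma ideal_sum J (I : eqType) (s : seq I) (G : I -> R) : is_ideal J ->
  (forall i, i \in s -> J (G i)) -> J (\sum_(i <- s) G i).
Proof.
case=> J0 JD _ h; rewrite big_seq; elim/big_ind: _ => //.
Qed.

Lemma idealN J x : is_ideal J -> J x -> J (- x).
Proof. by case=> _ _ JM Jx; rewrite -mulN1r; apply: JM. Qed.

Lemma idealB J x y : is_ideal J -> J x -> J y -> J (x - y).
Proof. by move=> idJ Jx Jy; case: (idJ) => _ JD _; apply: JD => //; apply: idealN. Qed.

Fixpoint gen_ideal l x : Prop :=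
  if l is a :: l' then exists b, gen_ideal l' (x - b * a) else x = 0.

Lemma gen_ideal_is_ideal l : is_ideal (gen_ideal l).
Proof.
elim: l => [|a l [I0 ID IM]].
  by split=> [|x y /= -> ->|r x /= ->] //=; rewrite ?addr0 ?mulr0.
split=> [|x y [b xb] [c yc]|r x [b xb]].
- by exists 0; rewrite mul0r subr0.
- by exists (b + c); rewrite mulrDl opprD addrACA; apply: ID.
- by exists (r * b); rewrite -mulrA -mulrBr; apply: IM.
Qed.

Lemma gen_ideal_mem l a : a \in l -> gen_ideal l a.
Proof.
elim: l => //= b l IH; rewrite inE => /predU1P[->|/IH la].
  by exists 1; rewrite mul1r subrr; case: (gen_ideal_is_ideal l).
by exists 0; rewrite mul0r subr0.
Qed.

Lemma gen_ideal_min J l x : is_ideal J -> (forall a, a \in l -> J a) ->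
  gen_ideal l x -> J x.
Proof.
move=> idJ; elim: l x => [|a l IH] x lJ /=; first by move=> ->; case: idJ.
case=> b xb; rewrite -(subrK (b * a) x); case: (idJ) => _ JD JM.
apply: JD; last by apply/JM/lJ; rewrite mem_head.
by apply: IH xb => c cl; apply: lJ; rewrite inE cl orbT.
Qed.

Lemma gen_ideal_sub l l' x : {subset l <= l'} -> gen_ideal l x -> gen_ideal l' x.
Proof.
move=> sub; apply: gen_ideal_min; first exact: gen_ideal_is_ideal.
by move=> a /sub; apply: gen_ideal_mem.
Qed.

Definition noetherian := forall J, is_ideal J ->
  exists2 l, (forall a, a \in l -> J a) & forall x, J x -> gen_ideal l x.

Lemma union_ideal (J : nat -> R -> Prop) : (forall n, is_ideal (J n)) ->
  (forall n x, J n x -> J n.+1 x) -> is_ideal (fun x => exists n, J n x).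
Proof.
move=> idJ inc; have mono n m x : (n <= m)%N -> J n x -> J m x.
  by move=> nm Jx; rewrite -(subnK nm); elim: (m - n)%N => //= d /inc.
split; first by exists 0%N; case: (idJ 0%N).
  move=> x y [n xn] [m ym]; exists (maxn n m).
  by case: (idJ (maxn n m)) => _ JD _; apply: JD; [apply: mono xn | apply: mono ym];
    rewrite ?leq_maxl ?leq_maxr.
by move=> r x [n xn]; exists n; case: (idJ n) => _ _; apply.
Qed.

Lemma noetherian_chain (J : nat -> R -> Prop) : noetherian ->
  (forall n, is_ideal (J n)) -> (forall n x, J n x -> J n.+1 x) ->
  exists n, forall x, J n.+1 x -> J n x.
Proof.
move=> noeth idJ inc; have mono n m x : (n <= m)%N -> J n x -> J m x.
  by move=> nm Jx; rewrite -(subnK nm); elim: (m - n)%N => //= d /inc.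
have [l lJ Jl] := noeth _ (union_ideal idJ inc).
have [n ln] : exists n, forall a, a \in l -> J n a.
  elim: l lJ {Jl} => [|a l IH] lJ; first by exists 0%N.
  have [|n hn] := IH; first by move=> b bl; apply: lJ; rewrite inE bl orbT.
  have [m hm] := lJ a (mem_head _ _); exists (maxn n m) => b.
  rewrite inE => /predU1P[->|/hn bn].
    by apply: mono hm; rewrite leq_maxr.
  by apply: mono bn; rewrite leq_maxl.
exists n => x Jx; apply: (gen_ideal_min (idJ n) ln); apply: Jl; by exists n.+1.
Qed.

(** Without a maximal element above [J0], choice produces a strictly increasing chain of ideals. *)
Lemma noetherian_maximal (P : (R -> Prop) -> Prop) J0 : noetherian ->
  (forall J, P J -> is_ideal J) -> P J0 ->
  exists J, [/\ P J, forall x, J0 x -> J x &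
    forall J', P J' -> (forall x, J x -> J' x) -> forall x, J' x -> J x].
Proof.
move=> noeth idP PJ0; apply: contrapT => no.
pose T := {J | P J /\ forall x, J0 x -> J x}.
have next (J : T) : exists J' : T,
    (forall x, sval J x -> sval J' x) /\ ~ (forall x, sval J' x -> sval J x).
  case: J => J [PJ JJ]; apply: contrapT => no'; apply: no.
  exists J; split=> // J' PJ' sub x J'x; apply: contrapT => nJx; apply: no'.
  have J'J y : J0 y -> J' y by move/JJ/sub.
  exists (exist _ J' (conj PJ' J'J)); split=> //= h; exact/nJx/h.
have [s hs] := choice next.
pose J n := iter n s (exist _ J0 (conj PJ0 (fun _ => id)) : T).
have [||n hn] := @noetherian_chain (fun n => sval (J n)) noeth.
- by move=> n; apply: idP; case: (J n) => ? [].
- by move=> n; apply: (hs (J n)).1.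
- exact: (hs (J n)).2.
Qed.

End Ideals.

Lemma field_noetherian (F : fieldType) : noetherian F.
Proof.
move=> J [J0 JD JM]; have [[x Jx x0]|no] := pselect (exists2 x, J x & x != 0).
  exists [:: 1] => [a|y _]; last by exists y; rewrite mulr1 subrr.
  by rewrite inE => /eqP ->; rewrite -(mulVf x0); apply: JM.
exists [::] => // x Jx /=; apply/eqP; apply: contrapT => /negP x0.
by apply: no; exists x.
Qed.

Lemma surjective_noetherian (R S : comNzRingType) (phi : {rmorphism R -> S}) :
  (forall y, exists x, phi x = y) -> noetherian R -> noetherian S.
Proof.
move=> surj noeth J [J0 JD JM].
have [|l lJ Jl] := noeth (fun x => J (phi x)).
  split=> [|x y|r x]; rewrite ?rmorph0 ?rmorphD ?rmorphM //; [exact: JD | exact: JM].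
exists (map phi l) => [_ /mapP[a al ->]|y]; first exact: lJ.
have [x <-] := surj y => /Jl; elim: l x {lJ Jl} => [|a l IH] x /=.
  by move=> ->; rewrite rmorph0.
by case=> b /IH; rewrite rmorphB rmorphM; exists (phi b).
Qed.

(** Multiplying each generator by a power of ['X] brings all of them to the common size [d], so that
    a combination of leading coefficients becomes one of polynomials. *)
Lemma gen_ideal_lead_coef (R : comNzRingType) (l : seq {poly R}) a d :
  (forall q, q \in l -> size q <= d)%N -> gen_ideal [seq lead_coef q | q <- l] a ->
  exists r, [/\ gen_ideal l r, (size r <= d)%N & r`_d.-1 = a].
Proof.
elim: l a => [|q l IH] a ld /=; first by move=> ->; exists 0; rewrite size_poly0 coef0.
case=> b /IH[|r [rl sr cr]]; first by move=> q' q'l; apply: ld; rewrite inE q'l orbT.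
have qd : (size q <= d)%N by apply: ld; rewrite mem_head.
have sbq : (size (b%:P * 'X^(d - size q) * q)%R <= d)%N.
  rewrite -mulrA mul_polyC; apply: leq_trans (size_scale_leq _ _) _.
  apply: leq_trans (size_polyMleq _ _) _; rewrite size_polyXn addSn /=.
  by rewrite subnK.
exists (r + b%:P * 'X^(d - size q) * q); split.
- by exists (b%:P * 'X^(d - size q)); rewrite addrK.
- by apply: leq_trans (size_polyD _ _) _; rewrite geq_max sr.
rewrite coefD cr -mulrA coefCM coefXnM -[RHS](subrK (b * lead_coef q)).
congr (_ + _ * _); rewrite lead_coefE.
have [->|q0] := eqVneq q 0; first by rewrite !coef0 if_same.
have := size_poly_gt0 q; rewrite q0 => sq.
by rewrite ifF; [congr (q`_ _); lia | lia].
Qed.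

(** Hilbert's argument: keep choosing an element of least size in [J] outside the ideal of the
    previous ones. Once the ideals of leading coefficients stabilize, a combination of earlier
    choices cancels the leading term of the next one, against its minimality. *)
Lemma poly_noetherian (R : comNzRingType) : noetherian R -> noetherian {poly R}.
Proof.
move=> noeth J idJ; apply: contrapT => no; case: (idJ) => J0 JD JM.
pose good (l : seq {poly R}) := forall a, a \in l -> J a.
pose min_new l (q : {poly R}) := [/\ J q, ~ gen_ideal l q &
  forall q', J q' -> ~ gen_ideal l q' -> (size q <= size q')%N].
have exnew l : good l -> exists q, min_new l q.
  move=> gl; pose Q n := exists q, [/\ J q, ~ gen_ideal l q & size q = n].
  have exQ : exists n, `[< Q n >].
    apply: contrapT => noQ; apply: no; exists l => // q Jq.
    by apply: contrapT => ql; apply: noQ; exists (size q); apply/asboolP; exists q.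
  case: (ex_minnP exQ) => n /asboolP[q [Jq ql sq]] minq.
  exists q; split=> // q' Jq' q'l; rewrite sq; apply: minq.
  by apply/asboolP; exists q'.
have exnew' l : exists q, good l -> min_new l q.
  have [gl|bl] := pselect (good l); last by exists 0.
  by have [q hq] := exnew l gl; exists q.
have [next hnext] := choice exnew'.
pose L n := iter n (fun l => rcons l (next l)) [::]; pose q n := next (L n).
have gL n : good (L n).
  elim: n => //= n IH a; rewrite mem_rcons inE => /predU1P[->|/IH //].
  by case: (hnext _ IH).
have hq n : min_new (L n) (q n) by apply: hnext.
have LS n : L n.+1 = rcons (L n) (q n) by [].
have qL i n : (i < n)%N -> q i \in L n.
  elim: n => // n IH; rewrite ltnS leq_eqVlt LS mem_rcons inE => /predU1P[->|/IH ->].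
    by rewrite eqxx.
  by rewrite orbT.
have sizeq i n : (i <= n)%N -> (size (q i) <= size (q n))%N.
  move=> le; have [_ _] := hq i; apply; have [Jq nq _] := hq n => // qi.
  apply: nq; apply: gen_ideal_sub qi => a.
  elim: n le {Jq} => [|n IH]; first by rewrite leqn0 => /eqP ->.
  rewrite leq_eqVlt => /predU1P[-> //|]; rewrite ltnS => /IH h /h.
  by rewrite LS mem_rcons inE orbC => ->.
pose lead n := [seq lead_coef (q i) | i <- iota 0 n].
have [||n hn] := @noetherian_chain R (fun n => gen_ideal (lead n)) noeth.
- by move=> n; apply: gen_ideal_is_ideal.
- move=> n x; apply: gen_ideal_sub => a /mapP[i + ->]; rewrite mem_iota /= => lt.
  by apply: (map_f (fun i => lead_coef (q i))); rewrite mem_iota /= ltnS ltnW.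
have [Jq nq minq] := hq n.
have q0 : (0 < size (q n))%N.
  rewrite size_poly_gt0; apply/eqP => q0; apply: nq; rewrite q0.
  by case: (gen_ideal_is_ideal (L n)).
have lq : gen_ideal (lead n) (lead_coef (q n)).
  apply: (hn (lead_coef (q n))); apply: gen_ideal_mem.
  by apply: (map_f (fun i => lead_coef (q i))); rewrite mem_iota /= ltnS.
have [||r [rq sr cr]] := @gen_ideal_lead_coef R [seq q i | i <- iota 0 n] (lead_coef (q n)) (size (q n)).
- move=> _ /mapP[i + ->]; rewrite mem_iota => /andP[_ lt]; apply: sizeq; exact: ltnW.
- by rewrite -map_comp; exact: lq.
have rL : gen_ideal (L n) r.
  by apply: gen_ideal_sub rq => _ /mapP[i + ->]; rewrite mem_iota => /andP[_ /qL].
have : (size (q n) <= size (q n - r)%R)%N.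
  apply: minq; first by apply: idealB => //; exact: (gen_ideal_min idJ (gL n) rL).
  move=> h; apply: nq; rewrite -(subrK r (q n)).
  by case: (gen_ideal_is_ideal (L n)) => _ ID _; apply: ID.
apply/negP; rewrite -ltnNge -(prednK q0) ltnS; apply/leq_sizeP => j.
rewrite leq_eqVlt coefB => /predU1P[<-|lt]; first by rewrite cr subrr.
have szj : (size (q n) <= j)%N by rewrite -(prednK q0).
by rewrite !nth_default ?subrr // (leq_trans sr).
Qed.

(** * Polynomials in several variables *)

Section MultivariateNoetherian.
Import multinomials.mpoly.
Variable F : fieldType.

Lemma mpoly_ring_ind n (Q : {mpoly F[n]} -> Prop) :
  (forall c, Q c%:MP) -> (forall i, Q 'X_i) ->
  (forall p q, Q p -> Q q -> Q (p + q)) -> (forall p q, Q p -> Q q -> Q (p * q)) ->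
  forall p, Q p.
Proof.
move=> QC QX QD QM p; rewrite [p]mpolyE; apply: (big_ind Q (QC 0) QD) => m _.
rewrite -mul_mpolyC; apply: (QM _ _ (QC _)); rewrite mpolyXE_id.
apply: (big_ind Q (QC 1) QM) => j _.
by elim: (m j) => [|d IH]; [exact: (QC 1) | rewrite exprS; apply: QM].
Qed.

(** The variable of the outer polynomial becomes the last variable; this is the induction step on
    the number of variables. *)
Definition mpoly_of_poly n : {poly {mpoly F[n]}} -> {mpoly F[n.+1]} :=
  horner_eval 'X_ord_max \o map_poly (@mwiden n F).

HB.instance Definition _ n := GRing.RMorphism.on (@mpoly_of_poly n).

Lemma mpoly_of_poly_surjective n (p : {mpoly F[n.+1]}) : exists q, mpoly_of_poly q = p.
Proof.
elim/mpoly_ring_ind: p => [c|i|p1 p2 [q1 <-] [q2 <-]|p1 p2 [q1 <-] [q2 <-]].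
- exists (c%:MP)%:P.
  by rewrite /mpoly_of_poly /= map_polyC horner_evalE hornerC /= mwidenC.
- have [j ->|->] := unliftP ord_max i; last first.
    by exists 'X; rewrite /mpoly_of_poly /= map_polyX horner_evalE hornerX.
  exists ('X_j)%:P.
  rewrite /mpoly_of_poly /= map_polyC horner_evalE hornerC /= mwidenX mnmwiden1.
  by congr 'X_[U_(_)]; apply: val_inj; rewrite /= /bump leqNgt ltn_ord.
- by exists (q1 + q2); rewrite rmorphD.
- by exists (q1 * q2); rewrite rmorphM.
Qed.

Lemma mpoly_noetherian n : noetherian {mpoly F[n]}.
Proof.
elim: n => [|n IH].
  apply: (@surjective_noetherian F _ (@mpolyC 0 F)); last exact: field_noetherian.
  by move=> p; exists p@_0%MM; rewrite [RHS]nvar0_mpolyC.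
exact: surjective_noetherian (@mpoly_of_poly_surjective n) (poly_noetherian IH).
Qed.

Lemma meval_mwiden n (a : 'I_n.+1 -> F) (q : {mpoly F[n]}) :
  (mwiden q).@[a] = q.@[fun i => a (widen_ord (leqnSn n) i)].
Proof.
elim/mpolyind: q => [|c m q _ _ IH]; first by rewrite !raddf0.
rewrite !raddfD /= IH; congr (_ + _); rewrite mwidenZ !mevalZ mwidenX !mevalX big_ord_recr /= mnmwiden_ordmax expr0 mulr1.
by congr (_ * _); apply: eq_bigr => i _; rewrite mnmwiden_widen.
Qed.

End MultivariateNoetherian.

Section Vanishing.
Import multinomials.mpoly.
Variable F : numFieldType.

Lemma poly_vanish (p : {poly F}) : (forall a, p.[a] = 0) -> p = 0.
Proof.
move=> p0; apply/eqP; apply: contraT => pn0.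
have := @max_poly_roots _ p [seq i%:R | i <- iota 0 (size p)] pn0.
rewrite size_map size_iota ltnn; apply.
  by apply/allP => a _; rewrite rootE p0.
by rewrite map_inj_uniq ?iota_uniq // => i j /eqP; rewrite eqr_nat => /eqP.
Qed.

Lemma mpoly_vanish n (p : {mpoly F[n]}) : (forall a, p.@[a] = 0) -> p = 0.
Proof.
elim: n p => [|n IH] p p0.
  by rewrite [p]nvar0_mpolyC; have := p0 (fun=> 0); rewrite {1}[p]nvar0_mpolyC mevalC => ->.
have [q qp] := mpoly_of_poly_surjective p.
suff q0 : q = 0 by rewrite -qp q0 rmorph0.
apply/polyP => i; rewrite coef0; apply: IH => a.
have : map_poly (meval a) q = 0.
  apply: poly_vanish => t.
  pose b (j : 'I_n.+1) := if unlift ord_max j is Some j' then a j' else t.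
  have := p0 b; rewrite -qp /mpoly_of_poly /= horner_evalE.
  have -> : forall (r : {poly {mpoly F[n]}}),
    (map_poly (@mwiden n F) r).['X_ord_max].@[b] = (map_poly (meval a) r).[t]; last by [].
  elim/poly_ind => [|r c IHr]; first by rewrite !rmorph0 !horner0 meval0.
  rewrite !rmorphD !rmorphM /= !map_polyX !map_polyC !hornerE mevalD mevalM IHr mevalXU /=.
  rewrite /b unlift_none meval_mwiden; congr (_ + _); apply: meval_eq => j.
  have -> : widen_ord (leqnSn n) j = lift ord_max j.
    by apply: val_inj; rewrite /= /bump leqNgt ltn_ord.
  by rewrite liftK.
by move/polyP/(_ i); rewrite coef_map coef0.
Qed.

End Vanishing.

(** * The Nullstellensatz over an uncountable algebraically closed field *)

Section Nullstellensatz.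
Import multinomials.mpoly.
Variables (C : closedFieldType) (n : nat).
Implicit Types (J : {mpoly C[n]} -> Prop) (p q : {mpoly C[n]}).

Lemma mpoly_dependent (s : seq C) (g : C -> {mpoly C[n]}) B :
  (forall x, x \in s -> msize (g x) <= B)%N -> (#|{: 'X_{1..n < B}}| < size s)%N ->
  exists2 v : 'I_(size s) -> C, (exists i, v i != 0) &
    \sum_i v i *: g (s`_i) = 0.
Proof.
move=> gB ltB.
pose A : 'M[C]_(size s, #|{: 'X_{1..n < B}}|) :=
  \matrix_(i, j) (g s`_i)@_(val (enum_val j)).
have /matrix0Pn[i0 [j0 kij]] : kermx A != 0.
  rewrite kermx_eq0 /row_free neq_ltn; apply/orP; left.
  by apply: leq_ltn_trans (rank_leq_col _) ltB.
exists (fun j => kermx A i0 j); first by exists j0.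
apply/mpolyP => m; rewrite mcoeff0 raddf_sum /=.
have [mB|mB] := ltnP (mdeg m) B; last first.
  rewrite big1 // => i _; rewrite mcoeffZ memN_msupp_eq0 ?mulr0 //.
  by apply: msize_mdeg_ge; apply: leq_trans mB; apply/gB/mem_nth.
have /matrixP/(_ i0 (enum_rank (BMultinom mB))) := mulmx_ker A.
rewrite [LHS]mxE [RHS]mxE => e; rewrite -[RHS]e; apply: eq_bigr => i _.
by rewrite mcoeffZ [A _ _]mxE enum_rankK.
Qed.

Section Maximal.
Variables (J P : {mpoly C[n]} -> Prop) (i : 'I_n).
Hypothesis idP : is_ideal P.
Hypothesis nP : forall N, ~ P ('X_i ^+ N).
Hypothesis maxP : forall P', is_ideal P' -> (forall N, ~ P' ('X_i ^+ N)) ->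
  (forall q, P q -> P' q) -> forall q, P' q -> P q.

(** By maximality the larger ideal P + (q) contains a power of ['X_i]: once ['X_i] is inverted, the
    quotient by [P] is a field. *)
Lemma maximal_power q : ~ P q -> exists N r s, P r /\ 'X_i ^+ N = r + s * q.
Proof.
move=> nPq; apply: contrapT => no; apply: nPq.
case: (idP) => P0 PD PM.
apply: (maxP (P' := fun x => exists r s, P r /\ x = r + s * q)).
- split; first by exists 0, 0; rewrite mul0r addr0.
    move=> _ _ [r [s [Pr ->]]] [r' [s' [Pr' ->]]]; exists (r + r'), (s + s').
    by split; [exact: PD | rewrite mulrDl addrACA].
  move=> a _ [r [s [Pr ->]]]; exists (a * r), (a * s).
  by split; [exact: PM | rewrite mulrDr mulrA].
- by move=> N [r [s [Pr e]]]; apply: no; exists N, r, s.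
- by move=> r Pr; exists r, 0; rewrite mul0r addr0.
- by exists 0, 1; rewrite mul1r add0r.
Qed.

Lemma maximal_cancel N q : P ('X_i ^+ N * q) -> P q.
Proof.
move=> PNq; apply: contrapT => /maximal_power[M [r [s [Pr e]]]].
apply: (nP (N := N + M)); rewrite exprD e mulrDr; case: (idP) => _ PD PM.
apply: PD; first exact: PM.
by rewrite mulrCA; apply: PM.
Qed.

(* Uncountably many inverses of the 'X_j - x modulo P would be linearly independent
   in a space of countable dimension. *)
Lemma maximal_coordinate j :
  (forall d : C -> nat, exists N, forall M, exists s : seq C,
    [/\ uniq s, size s = M & forall x, x \in s -> (d x <= N)%N]) ->
  exists x, P ('X_j - x%:MP).
Proof.
move=> unc; apply: contrapT => noP.
have nPx x : ~ P ('X_j - x%:MP) by move=> Px; apply: noP; exists x.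
have /choice[f hf] x : exists t : nat * {mpoly C[n]},
    P ('X_i ^+ t.1 - t.2 * ('X_j - x%:MP)).
  have [N [r [s [Pr e]]]] := maximal_power (@nPx x).
  by exists (N, s); rewrite /= e addrK.
have [N hN] := unc (fun x => maxn (f x).1 (msize (f x).2)).
have [s [us ss sN]] := hN #|{: 'X_{1..n < (N + N).+2}}|.+1.
case: (idP) => P0 PD PM.
(* [g x] stands for ['X_i ^+ N] divided by ['X_j - x] modulo [P]; the padding gives all [x] in [s]
   the same exponent. *)
pose g x := 'X_i ^+ (N - (f x).1) * (f x).2.
have gP x : x \in s -> P ('X_i ^+ N - g x * ('X_j - x%:MP)).
  move=> /sN; rewrite geq_max => /andP[le _].
  by rewrite /g -mulrA -{1}(subnK le) exprD -mulrBr; apply: PM.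
have gB x : x \in s -> (msize (g x) <= (N + N).+2)%N.
  move=> /sN; rewrite geq_max => /andP[le1 le2]; rewrite /g.
  apply: leq_trans (msizeM_le _ _) _; rewrite mpolyXn msizeX mdegMn mdeg1 mul1n addSn.
  by rewrite !ltnS; apply: leq_add => //; apply: leq_subr.
have [|v [i0 vi0] sv] := mpoly_dependent gB; first by rewrite ss.
(* Denominators are cleared in the relation between the inverses. At a point of [s] only one [w l]
   is nonzero, so [q] is nonzero as soon as some [v l] is. *)
pose w (l : 'I_(size s)) : {poly C} := \prod_(k | k != l) ('X - (s`_k)%:P).
pose q := \sum_l v l *: w l.
have q0 : q != 0.
  apply: contra vi0 => /eqP/(congr1 (fun r => r.[s`_i0])); rewrite horner0 /q horner_sum.
  rewrite (bigD1 i0) //= big1 ?addr0 => [/eqP|l li0].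
    rewrite hornerZ mulf_eq0 => /orP[//|]; rewrite /w horner_prod prodf_seq_eq0.
    case/hasP=> k _ /=; rewrite hornerXsubC subr_eq0 => /andP[ki0].
    by rewrite nth_uniq // eq_sym (inj_eq val_inj) (negPf ki0).
  rewrite hornerZ /w horner_prod (bigD1 i0) 1?eq_sym //=.
  by rewrite hornerXsubC subrr mul0r mulr0.
pose phi (r : {poly C}) : {mpoly C[n]} := (map_poly (@mpolyC n C) r).['X_j].
have phiM r1 r2 : phi (r1 * r2) = phi r1 * phi r2 by rewrite /phi rmorphM hornerM.
have phiX x : phi ('X - x%:P) = 'X_j - x%:MP.
  by rewrite /phi rmorphB /= map_polyX map_polyC hornerXsubC.
have phi_w l : phi (w l) = \prod_(k | k != l) ('X_j - (s`_k)%:MP).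
  rewrite /phi /w rmorph_prod horner_prod; apply: eq_bigr => k _; exact: phiX.
have Pq : P (phi q).
  apply: (@maximal_cancel N).
  have -> : 'X_i ^+ N * phi q =
      \sum_l (v l)%:MP * phi (w l) * ('X_i ^+ N - g s`_l * ('X_j - (s`_l)%:MP)).
    under eq_bigr do rewrite mulrBr; rewrite sumrB [X in _ - X](_ : _ = 0).
      rewrite subr0 /phi /q raddf_sum horner_sum mulr_sumr; apply: eq_bigr => l _ /=.
      by rewrite -mul_polyC rmorphM /= map_polyC hornerM hornerC mulrC.
    transitivity ((\sum_l v l *: g s`_l) * \prod_(k < size s) ('X_j - (s`_k)%:MP)).
      rewrite mulr_suml; apply: eq_bigr => l _.
      rewrite (bigD1 l) //= -phi_w -mul_mpolyC; ring.
    by rewrite sv mul0r.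
  by apply: ideal_sum => // l _; apply: PM; apply: gP; apply: mem_nth.
(* No factor ['X_j - x] lies in [P], so the factors can be cancelled one by one until 1 lies in
   [P]. *)
have [r qE] := closed_field_poly_normal q.
have lq : lead_coef q != 0 by rewrite lead_coef_eq0.
have {}Pq : P (phi (\prod_(z <- r) ('X - z%:P))).
  move: (PM (lead_coef q)^-1%:MP _ Pq); rewrite {2}qE -mul_polyC phiM.
  by rewrite /phi map_polyC hornerC /= mulrA -mpolyCM mulVf // mpolyC1 mul1r.
elim: r {qE} Pq => [|x r IH].
  rewrite big_nil /phi rmorph1 hornerC => P1; apply: (nP (N := 0)).
  by rewrite expr0.
rewrite big_cons phiM phiX => Pxr; apply: IH.
have [N' [a [b [Pa e]]]] := maximal_power (@nPx x).
apply: (@maximal_cancel N'); rewrite e mulrDl; apply: PD.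
  by rewrite mulrC; apply: PM.
by rewrite -mulrA; apply: PM.
Qed.

End Maximal.

(** An ideal containing [J] and maximal for avoiding the powers of ['X_i] is the ideal of a point
    [a], which is a zero of [J]; then [a i = 0] puts ['X_i] itself in it. The first hypothesis is
    uncountability in pigeonhole form: some sublevel set of [d] is infinite. *)
Lemma nullstellensatz J (i : 'I_n) :
  (forall d : C -> nat, exists N, forall M, exists s : seq C,
    [/\ uniq s, size s = M & forall x, x \in s -> (d x <= N)%N]) ->
  is_ideal J -> (forall a, (forall q, J q -> q.@[a] = 0) -> a i = 0) ->
  exists N, J ('X_i ^+ N).
Proof.
move=> unc idJ zJ; apply: contrapT => noN.
pose fam (P : {mpoly C[n]} -> Prop) := is_ideal P /\ forall N, ~ P ('X_i ^+ N).
have [||P [[idP nP] JP maxP]] := @noetherian_maximal _ fam J (@mpoly_noetherian C n).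
- by move=> P [].
- by split=> // N JN; apply: noN; exists N.
have /choice[a ha] j : exists x, P ('X_j - x%:MP).
  apply: (maximal_coordinate idP nP) => // P' idP' nP' sub; exact: maxP.
case: (idP) => P0 PD PM.
pose Q (q : {mpoly C[n]}) := P (q - (q.@[a])%:MP).
have QC c : Q c%:MP by rewrite /Q mevalC subrr.
have QD q1 q2 : Q q1 -> Q q2 -> Q (q1 + q2).
  by move=> Q1 Q2; rewrite /Q mevalD mpolyCD opprD addrACA; apply: PD.
have QM q1 q2 : Q q1 -> Q q2 -> Q (q1 * q2).
  move=> Q1 Q2; rewrite /Q mevalM mpolyCM.
  have -> : q1 * q2 - (q1.@[a])%:MP * (q2.@[a])%:MP =
      q2 * (q1 - (q1.@[a])%:MP) + (q1.@[a])%:MP * (q2 - (q2.@[a])%:MP) by ring.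
  by apply: PD; apply: PM.
have QX j : Q 'X_j by rewrite /Q mevalXU.
have Qall := mpoly_ring_ind QC QX QD QM.
have ai0 : a i = 0.
  apply: zJ => q Jq; have := Qall q; rewrite /Q => Pq.
  apply/eqP; apply: contraT => qa.
  case: (nP 0%N); rewrite expr0.
  have := PM (- (q.@[a])^-1%:MP) _ (idealB idP Pq (JP _ Jq)).
  by rewrite addrAC subrr add0r mulrNN -mpolyCM mulVf.
by apply: (nP 1%N); rewrite expr1; have := ha i; rewrite ai0 mpolyC0 subr0.
Qed.

End Nullstellensatz.

(** * Derivations killing a homogeneous system of parameters *)

Section Derivations.
Variables (A : idomainType) (xi : A -> A).
Hypothesis xiD : forall a b, xi (a + b) = xi a + xi b.
Hypothesis xiM : forall a b, xi (a * b) = xi a * b + a * xi b.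
Hypothesis char0 : forall n, (n.+1%:R : A) != 0.

Lemma derivation0 : xi 0 = 0.
Proof. by apply: (addrI (xi 0)); rewrite -xiD !addr0. Qed.

Lemma derivationN a : xi (- a) = - xi a.
Proof. by apply/eqP; rewrite -addr_eq0 -xiD addNr derivation0. Qed.

Lemma derivation1 : xi 1 = 0.
Proof. by apply: (addrI (xi 1)); rewrite addr0 -{3}[1]mulr1 xiM mul1r mulr1. Qed.

Lemma derivation_sum I (s : seq I) (Q : pred I) (G : I -> A) :
  xi (\sum_(i <- s | Q i) G i) = \sum_(i <- s | Q i) xi (G i).
Proof. exact: (big_morph xi xiD derivation0). Qed.

Definition killed (p : {poly A}) := forall i, xi p`_i = 0.

Lemma killed1 : killed 1.
Proof. by move=> i; rewrite coef1; case: (_ == _); rewrite ?derivation1 ?derivation0. Qed.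

Lemma killedD p q : killed p -> killed q -> killed (p + q).
Proof. by move=> kp kq i; rewrite coefD xiD kp kq addr0. Qed.

Lemma killedM p q : killed p -> killed q -> killed (p * q).
Proof.
move=> kp kq i; rewrite coefM derivation_sum big1 // => j _.
by rewrite xiM kp kq mul0r mulr0 addr0.
Qed.

Lemma killedN p : killed p -> killed (- p).
Proof. by move=> kp i; rewrite coefN derivationN kp oppr0. Qed.

Lemma killed_char_poly n (Q : 'M[A]_n) : (forall i j, xi (Q i j) = 0) ->
  killed (char_poly Q).
Proof.
move=> kQ; have k0 : killed 0 by move=> i; rewrite coef0 derivation0.
rewrite /char_poly /determinant; apply: (big_ind killed k0 killedD) => s _.
apply: killedM; first by case: (perm.odd_perm s); rewrite ?expr1 ?expr0; [apply: killedN|]; exact: killed1.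
apply: (big_ind killed killed1 killedM) => i _; rewrite !mxE; apply: killedD.
  case: eqP => _; last by rewrite mulr0n.
  by move=> j; rewrite mulr1n coefX; case: (_ == _); rewrite ?derivation1 ?derivation0.
by apply: killedN => j; rewrite coefC; case: (_ == _); rewrite ?derivation0.
Qed.

Lemma derivation_horner p a : killed p -> xi p.[a] = (p^`()).[a] * xi a.
Proof.
elim/poly_ind: p => [|p c IH] kp; first by rewrite deriv0 !horner0 derivation0 mul0r.
have kpp : killed p by move=> i; have := kp i.+1; rewrite coefD coefMX coefC /= addr0.
have kc : xi c = 0 by have := kp 0%N; rewrite coefD coefMX coefC /= add0r.
rewrite derivD derivM derivX derivC addr0 mulr1 !hornerE xiD kc addr0 xiM IH //.
by rewrite mulrDl mulrAC.
Qed.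

Lemma killed_deriv p : killed p -> killed p^`().
Proof.
move=> kp i; rewrite coef_deriv; set a := p`_ _; have : xi a = 0 by exact: kp.
elim: i.+1 a => [|m IH] a xa; first by rewrite mulr0n derivation0.
by rewrite mulrS xiD xa IH ?addr0.
Qed.

(** Applying [xi] to p(a) = 0 gives p'(a) xi(a) = 0. If p'(a) = 0, pass to p', of smaller size; in
    characteristic 0, p' = 0 would make p a nonzero constant. *)
Lemma derivation_algebraic p a : killed p -> p != 0 -> p.[a] = 0 -> xi a = 0.
Proof.
have [m] := ubnP (size p); elim: m p => // m IH p; rewrite ltnS => pm kp p0 pa.
have [da|/mulfI inj] := eqVneq (p^`()).[a] 0; last first.
  by apply: inj; rewrite mulr0 -derivation_horner // pa derivation0.
have [d0|d0] := eqVneq p^`() 0.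
  have sp : (size p <= 1)%N.
    apply/leq_sizeP => -[//|i] _; have := congr1 (fun q : {poly A} => q`_i) d0.
    rewrite coef_deriv coef0 -mulr_natr => /eqP; rewrite mulf_eq0 (negPf (char0 i)) orbF.
    by move/eqP.
  move: pa p0; rewrite (size1_polyC sp) hornerC => ->.
  by rewrite polyC0 eqxx.
by apply: (IH _ _ (killed_deriv kp)) => //; apply: leq_trans pm; apply: lt_size_deriv.
Qed.

(* The determinant trick: a acts on a finite module over the constants of xi. *)
Lemma derivation_finite n (v : 'I_n -> A) (i0 : 'I_n) a : v i0 = 1 ->
  (forall i, exists2 q : 'I_n -> A, (forall j, xi (q j) = 0) & a * v i = \sum_j q j * v j) ->
  xi a = 0.
Proof.
move=> vi0 h; have /choice[q hq] i : exists q : 'I_n -> A,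
    (forall j, xi (q j) = 0) /\ a * v i = \sum_j q j * v j.
  by have [q] := h i; exists q.
pose Q := \matrix_(i, j) q i j.
apply: (@derivation_algebraic (char_poly Q)).
- by apply: killed_char_poly => i j; rewrite mxE (hq i).1.
- exact: monic_neq0 (char_poly_monic _).
pose V : 'cV[A]_n := \col_i v i.
have QV : (a%:M - Q) *m V = 0.
  apply/matrixP => i j; rewrite mulmxBl mul_scalar_mx !mxE (hq i).2.
  by apply/eqP; rewrite subr_eq0; apply/eqP/eq_bigr => l _; rewrite !mxE.
have -> : (char_poly Q).[a] = \det (a%:M - Q).
  rewrite -[LHS]/(horner_eval a _) -det_map_mx; congr (\det _).
  apply/matrixP => i j; rewrite !mxE /= /horner_eval hornerD hornerN hornerC.
  by case: eqP => _; rewrite ?mulr1n ?mulr0n ?hornerX ?horner0.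
have := congr1 (mulmx (\adj (a%:M - Q))) QV.
rewrite mulmxA mul_adj_mx mulmx0 mul_scalar_mx => /matrixP/(_ i0 0).
by rewrite !mxE vi0 mulr1.
Qed.

End Derivations.

Section Weighted.
Import multinomials.mpoly.
Variables (C : numClosedFieldType) (n : nat) (w : 'I_n -> nat).
Variables (c : nat -> {mpoly C[n]}) (dg : nat -> nat).
Implicit Types (p q : {mpoly C[n]}) (m : 'X_{1..n}).

Definition wt m := (\sum_i m i * w i)%N.

Hypothesis dg_gt0 : forall j, (0 < dg j)%N.
Hypothesis c_hom : forall j m, m \in msupp (c j) -> wt m = dg j.
Hypothesis c_zero : forall a : 'I_n -> C, (forall j, (c j).@[a] = 0) -> forall i, a i = 0.
Hypothesis unc : forall d : C -> nat, exists N, forall M, exists s : seq C,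
    [/\ uniq s, size s = M & forall x, x \in s -> (d x <= N)%N].

Definition wcomp d p : {mpoly C[n]} := \sum_(m <- msupp p | wt m == d) p@_m *: 'X_[m].

Lemma mcoeff_wcomp d p m : (wcomp d p)@_m = if wt m == d then p@_m else 0.
Proof.
rewrite /wcomp raddf_sum /=; case: ifP => wm; last first.
  rewrite big1_seq // => m' /andP[/eqP wm' _]; rewrite mcoeffZ mcoeffX.
  by case: eqP => [e|_]; rewrite ?mulr0 //; rewrite -e wm' eqxx in wm.
have [mp|mp] := boolP (m \in msupp p); last first.
  rewrite (memN_msupp_eq0 mp) big1_seq // => m' /andP[_ mp']; rewrite mcoeffZ mcoeffX.
  by case: eqP => [e|_]; rewrite ?mulr0 //; rewrite -e mp' in mp.
rewrite big_mkcond /= (bigD1_seq m) ?msupp_uniq //= wm mcoeffZ mcoeffX eqxx mulr1.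
rewrite big1 ?addr0 // => m' m'm; case: ifP => // _; rewrite mcoeffZ mcoeffX.
by rewrite (negPf m'm) mulr0.
Qed.

Lemma wcompD d p q : wcomp d (p + q) = wcomp d p + wcomp d q.
Proof.
by apply/mpolyP => m; rewrite mcoeffD !mcoeff_wcomp mcoeffD; case: ifP; rewrite ?addr0.
Qed.

Lemma wtD m m' : wt (m + m')%MM = (wt m + wt m')%N.
Proof. by rewrite /wt -big_split; apply: eq_bigr => i _; rewrite mnmDE mulnDl. Qed.

Lemma wcomp_hom p d : (forall m, m \in msupp p -> wt m = d) -> wcomp d p = p.
Proof.
move=> h; apply/mpolyP => m; rewrite mcoeff_wcomp; case: eqP => // wm.
by apply/esym/memN_msupp_eq0/negP => /h.
Qed.

Lemma wcomp_hom0 p d d' : (forall m, m \in msupp p -> wt m = d') -> d != d' -> wcomp d p = 0.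
Proof.
move=> h dd'; apply/mpolyP => m; rewrite mcoeff_wcomp mcoeff0; case: eqP => // wm.
by apply/memN_msupp_eq0/negP => /h e; rewrite -wm e eqxx in dd'.
Qed.

Variable xi : {mpoly C[n]} -> {mpoly C[n]}.
Hypothesis xiD : forall a b, xi (a + b) = xi a + xi b.
Hypothesis xiM : forall a b, xi (a * b) = xi a * b + a * xi b.
Hypothesis xiC : forall a, xi a%:MP = 0.
Hypothesis xic : forall j, xi (c j) = 0.

Lemma weighted_power : exists N, forall i, exists k (b : nat -> {mpoly C[n]}),
  'X_i ^+ N = \sum_(j < k) b j * c j.
Proof.
pose J p := exists k (b : nat -> {mpoly C[n]}), p = \sum_(j < k) b j * c j.
have idJ : is_ideal J.
  split; first by exists 0%N, (fun=> 0); rewrite big_ord0.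
    have ext p k (b : nat -> {mpoly C[n]}) l : p = \sum_(j < k) b j * c j -> (k <= l)%N ->
        p = \sum_(j < l) (if (j < k)%N then b j else 0) * c j.
      move=> -> kl; rewrite (big_ord_widen l (fun j => b j * c j)) //.
      rewrite big_mkcond; apply: eq_bigr => j _; case: ifP => //; by rewrite mul0r.
    move=> p q [k [b pE]] [l [b' qE]].
    exists (maxn k l), (fun j => (if (j < k)%N then b j else 0) + (if (j < l)%N then b' j else 0)).
    rewrite (ext _ _ _ _ pE (leq_maxl k l)) (ext _ _ _ _ qE (leq_maxr k l)) -big_split.
    by apply: eq_bigr => j _; rewrite mulrDl.
  move=> r p [k [b ->]]; exists k, (fun j => r * b j); rewrite mulr_sumr.
  by apply: eq_bigr => j _; rewrite mulrA.
have Jc j : J (c j).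
  exists j.+1, (fun i => (i == j)%:R); rewrite big_ord_recr /= eqxx mul1r big1 ?add0r // => i _.
  by rewrite ltn_eqF ?mul0r.
have /choice[N hN] i : exists N, J ('X_i ^+ N).
  by apply: nullstellensatz => // a za; apply: c_zero => j; apply: za.
exists (\max_i N i) => i; case: (idJ) => _ _ JM.
by rewrite -(subnK (leq_bigmax i)) exprD; apply: JM.
Qed.

(** The polynomial ring is spanned, over the constants of [xi], by the finitely many monomials of
    degree below [B]; then [derivation_finite] applies. *)
Lemma weighted_derivation0 i : xi 'X_i = 0.
Proof.
(* By pigeonhole, a monomial of degree at least [B] is divisible by some ['X_l ^+ N]. *)
have [N hN] := weighted_power; pose B := (n * N).+1.
pose S p := exists2 q : 'X_{1..n < B} -> {mpoly C[n]}, (forall u, xi (q u) = 0) &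
  p = \sum_(u : 'X_{1..n < B}) q u * 'X_[u].
have S0 : S 0 by exists (fun=> 0) => [_|]; rewrite -?mpolyC0 ?xiC // big1 // => u _; rewrite mpolyC0 mul0r.
have SD p q : S p -> S q -> S (p + q).
  move=> [b kb ->] [b' kb' ->]; exists (fun u => b u + b' u) => [u|].
    by rewrite xiD kb kb' addr0.
  by rewrite -big_split; apply: eq_bigr => u _; rewrite mulrDl.
have SM a p : xi a = 0 -> S p -> S (a * p).
  move=> ka [b kb ->]; exists (fun u => a * b u) => [u|].
    by rewrite xiM kb ka mul0r mulr0 addr0.
  by rewrite mulr_sumr; apply: eq_bigr => u _; rewrite mulrA.
have SX m : S 'X_[m].
  have [d] := ubnP (wt m); elim: d m => // d IH m; rewrite ltnS => wm.
  have [mB|Bm] := ltnP (mdeg m) B.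
    exists (fun u => (val u == m)%:R) => [u|].
      by case: (_ == _); rewrite -?mpolyC1 -?mpolyC0 ?xiC.
    rewrite (bigD1 (BMultinom mB)) //= eqxx mul1r big1 ?addr0 // => u um.
    by rewrite (negPf (um : val u != m)) mul0r.
  have [l lN] : exists l, (N <= m l)%N.
    apply/existsP; apply: contraLR Bm; rewrite negb_exists -ltnNge ltnS mdegE => /forallP h.
    rewrite -[X in (_ <= X * _)%N]card_ord -sum_nat_const; apply: leq_sum => l _.
    by have := h l; rewrite -ltnNge; apply: ltnW.
  have [k [b bE]] := hN l.
  have mE : 'X_[m] = \sum_(j < k) ('X_[m - U_(l) *+ N] * b j) * c j.
    rewrite -[m in LHS](@submK _ (U_(l) *+ N)%MM) ?mpolyXD.
      rewrite -mpolyXn bE mulr_sumr; apply: eq_bigr => j _; exact: mulrA.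
    apply/mnm_lepP => l'; rewrite mulmnE mnm1E; case: eqP => [<-|_]; by rewrite ?mul1n ?mul0n.
  (* Taking components of weight [wt m] leaves only coefficients of weight [wt m - dg j], smaller as
     [dg j > 0], so the induction on weights applies. *)
  have wm' : wcomp (wt m) 'X_[m] = 'X_[m].
    by apply: wcomp_hom => m'; rewrite msuppX inE => /eqP ->.
  have wsum (I : Type) (s : seq I) (G : I -> {mpoly C[n]}) :
      wcomp (wt m) (\sum_(x <- s) G x) = \sum_(x <- s) wcomp (wt m) (G x).
    apply: (big_morph _ (wcompD (wt m))).
    by apply/mpolyP => m'; rewrite mcoeff_wcomp mcoeff0 if_same.
  rewrite -wm' mE wsum; apply: (big_ind S S0 SD) => j _.
  set r := _ * b j; rewrite [r]mpolyE mulr_suml wsum; apply: (big_ind S S0 SD) => m' _.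
  have hm' m'' : m'' \in msupp (r@_m' *: 'X_[m'] * c j) -> wt m'' = (wt m' + dg j)%N.
    rewrite -scalerAl => /msuppZ_le; rewrite mulrC (perm_mem (msuppMX _ _)).
    by case/mapP=> m3 /c_hom <- ->; rewrite wtD.
  have [wE|wE] := eqVneq (wt m) (wt m' + dg j)%N; last by rewrite (wcomp_hom0 hm' wE).
  rewrite wE wcomp_hom //= mulrC; apply: (SM _ _ (xic _)); rewrite -mul_mpolyC; apply: (SM _ _ (xiC _)).
  by apply: IH; apply: leq_trans wm; rewrite wE -addn1 leq_add2l.
have Sall p : S p.
  rewrite [p]mpolyE; apply: (big_ind S S0 SD) => m _.
  by rewrite -mul_mpolyC; apply: (SM _ _ (xiC _)).
pose e (l : 'I_#|{: 'X_{1..n < B}}|) : {mpoly C[n]} := 'X_[enum_val l].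
have ch0 d : d.+1%:R != 0 :> {mpoly C[n]}.
  by rewrite -mpolyC_nat mpolyC_eq0; exact: lt0r_neq0 (ltr0Sn _ _).
have e0 : e (enum_rank (@bm0 n (n * N)%N : {: 'X_{1..n < B}})) = 1 by rewrite /e enum_rankK /= mpolyX0.
apply: (derivation_finite xiD xiM ch0 e0) => l.
have [q kq qE] := Sall ('X_i * e l); exists (fun j => q (enum_val j)) => [j|].
  exact: kq.
rewrite qE (reindex_onto enum_val enum_rank) /=.
  by apply: eq_bigl => j; rewrite enum_valK eqxx.
by move=> u _; rewrite enum_rankK.
Qed.

End Weighted.

(** * Uncountability of the real and complex numbers *)

Lemma small_set_avoided (R : realType) M (P : R -> Prop) (a b : R) : a < b ->
  ~ (exists s : seq R, [/\ uniq s, size s = M & forall x, x \in s -> P x]) ->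
  exists c d, [/\ a <= c, c < d, d <= b & forall x, c <= x <= d -> ~ P x].
Proof.
elim: M P a b => [|M IH] P a b ab noP; first by case: noP; exists [::].
(* If the first third contains a point of [P], the points from [v] on have one fewer to offer, and
   that point is distinct from all of them. *)
pose u := (2 * a + b) / 3; pose v := (a + 2 * b) / 3.
have [au uv vb] : [/\ a < u, u < v & v < b] by split; rewrite /u /v; lra.
have [[x /andP[ax xu] Px]|none] := pselect (exists2 x, a <= x <= u & P x); last first.
  exists a, u; split=> //; first by lra.
  by move=> x xau Px; apply: none; exists x.
have [|c [d [vc cd db noPx]]] := IH (fun y => P y /\ v <= y) v b vb.
  case=> s [us ss sP]; apply: noP; exists (x :: s); split=> /=.
  - by rewrite us andbT; apply/negP => /sP[_]; lra.
  - by rewrite ss.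
  - by move=> y; rewrite inE => /predU1P[-> //|/sP[]].
exists c, d; split=> //; first by lra.
by move=> y cyd Py; apply: (noPx y cyd); split=> //; case/andP: cyd; lra.
Qed.

(** Cantor's nested intervals: if every set {d <= N} were finite, closed intervals could avoid these
    sets one after the other. *)
Lemma real_uncountable (R : realType) (d : R -> nat) : exists N, forall M,
  exists s : seq R, [/\ uniq s, size s = M & forall x, x \in s -> (d x <= N)%N].
Proof.
apply: contrapT => no.
have small N : exists M, ~ (exists s : seq R,
    [/\ uniq s, size s = M & forall x, x \in s -> (d x <= N)%N]).
  by apply: contrapT => h; apply: no; exists N => M; apply: contrapT => h'; apply: h; exists M.
pose I := {q : R * R | q.1 < q.2}.
have step (N : nat) (q : I) : exists q' : I, [/\ (sval q).1 <= (sval q').1,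
    (sval q').2 <= (sval q).2 & forall x, (sval q').1 <= x <= (sval q').2 -> (N < d x)%N].
  case: q => [[a b] /= ab]; have [M hM] := small N.
  have [c [e [ac ce eb noe]]] := small_set_avoided ab hM.
  exists (exist _ (c, e) ce); split=> //= x /noe/negP; by rewrite -ltnNge.
have /choice[f hf] (t : nat * I) := step t.1 t.2.
pose q n := nat_rect (fun=> I) (exist _ (0, 1) ltr01 : I) (fun n r => f (n, r)) n.
pose a n := (sval (q n)).1; pose b n := (sval (q n)).2.
have ab n : a n < b n by rewrite /a /b; case: (q n).
have mono n m : (n <= m)%N -> a n <= a m /\ b m <= b n.
  move=> /subnK <-; elim: (m - n)%N => [|k [IH1 IH2]]; first by rewrite add0n.
  have [h1 h2 _] := hf ((k + n)%N, q (k + n)%N).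
  by split; [apply: le_trans h1 | apply: le_trans IH2].
have abm n m : a n <= b m.
  have [h1 _] := mono _ _ (leq_maxl n m); have [_ h2] := mono _ _ (leq_maxr n m).
  by apply: le_trans h1 (le_trans (ltW (ab _)) h2).
pose A := [set x | exists n, x = a n]%classic; pose c := sup A.
have supA : has_sup A.
  by split; [exists (a 0%N), 0%N | exists (b 0%N) => _ [n ->]].
have ac n : a n <= c by apply: sup_upper_bound => //; exists n.
have cb n : c <= b n by apply: ge_sup; [exists (a 0%N), 0%N | move=> _ [m ->]].
(* The step out of stage [d c] excludes all points where [d] is at most [d c], yet [c] lies in every
   interval. *)
have [_ _ /(_ c)] := hf (d c, q (d c)).
by rewrite ltnn; have := ac (d c).+1; have := cb (d c).+1; rewrite /a /b /= => -> -> /(_ isT).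
Qed.

Lemma complex_uncountable (R : realType) (d : R[i] -> nat) : exists N, forall M,
  exists s : seq R[i], [/\ uniq s, size s = M & forall x, x \in s -> (d x <= N)%N].
Proof.
have [N hN] := real_uncountable (fun x : R => d x%:C%C); exists N => M.
have [s [us ss sN]] := hN M; exists [seq x%:C%C | x <- s]; split.
- by rewrite map_inj_uniq // => x y [].
- by rewrite size_map.
- by move=> _ /mapP[x xs ->]; apply: sN.
Qed.

(** * The Zariski topology *)

Section PolynomialFunctions.
Import multinomials.mpoly.
Variable F : numFieldType.

Lemma mderivXU n (i j : 'I_n) : ('X_j : {mpoly F[n]})^`M(i) = (i == j)%:R.
Proof.
rewrite mderivX mnm1E eq_sym; case: eqP => [->|_]; last by rewrite scale0r.
rewrite scale1r -mpolyX0; congr 'X_[_].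
by apply/mnmP => l; rewrite mnmBE mnm0E subnn.
Qed.

Section Maps.
Variables (V : vectType F).

Lemma coordinatesD (u v : V) i : coordinates (u + v) i = coordinates u i + coordinates v i.
Proof. exact: linearD. Qed.

Lemma coordinatesZ a (v : V) i : coordinates (a *: v) i = a * coordinates v i.
Proof. exact: linearZ. Qed.

Lemma coordinates_basis (v : V) : v = \sum_(i < \dim {:V}) coordinates v i *: (vbasis {:V})`_i.
Proof. exact: coord_vbasis (memvf v). Qed.

Lemma pevalC c (v : V) : peval (c%:MP : polyfun V) v = c.
Proof. exact: mevalC. Qed.

Lemma pevalD (P Q : polyfun V) v : peval (P + Q : polyfun V) v = peval P v + peval Q v.
Proof. exact: mevalD. Qed.

Lemma pevalM (P Q : polyfun V) v : peval (P * Q : polyfun V) v = peval P v * peval Q v.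
Proof. exact: mevalM. Qed.

End Maps.

Section LinearMaps.
Variables (V W : vectType F).

Lemma peval_linear (L : 'Hom(V, W)) (P : polyfun W) :
  exists P' : polyfun V, forall v, peval P' v = peval P (L v).
Proof.
elim/mpoly_ring_ind: P => [c|i|p q [p' hp] [q' hq]|p q [p' hp] [q' hq]].
- by exists c%:MP => v; rewrite !pevalC.
- exists (\sum_(j < \dim {:V}) (coordinates (L ((vbasis {:V})`_j)) i) *: 'X_j) => v.
  rewrite /peval mevalXU raddf_sum [in RHS](coordinates_basis v) linear_sum /=.
  rewrite [RHS]linear_sum; apply: eq_bigr => j _ /=.
  by rewrite mevalZ mevalXU linearZ [RHS]linearZ mulrC.
- by exists (p' + q') => v; rewrite !pevalD hp hq.
- by exists (p' * q') => v; rewrite !pevalM hp hq.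
Qed.

Lemma peval_curve (y : F -> V) (P : polyfun V) :
  (forall i, exists q : {poly F}, forall t, q.[t] = coordinates (y t) i) ->
  exists q : {poly F}, forall t, q.[t] = peval P (y t).
Proof.
move=> hy; elim/mpoly_ring_ind: P => [c|i|p q [p' hp] [q' hq]|p q [p' hp] [q' hq]].
- by exists c%:P => t; rewrite hornerC /peval mevalC.
- by have [q hq] := hy i; exists q => t; rewrite /peval mevalXU hq.
- by exists (p' + q') => t; rewrite hornerD hp hq pevalD.
- by exists (p' * q') => t; rewrite hornerM hp hq pevalM.
Qed.

Lemma pderiv_line (P : polyfun V) (v w : V) : exists q : {poly F},
  (forall t, q.[t] = peval P (v + t *: w)) /\ q^`().[0] = pderiv P v w.
Proof.
elim/mpoly_ring_ind: P => [c|i|p q [p' [hp dp]] [q' [hq dq]]|p q [p' [hp dp]] [q' [hq dq]]].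
- exists c%:P; split=> [t|]; first by rewrite hornerC /peval mevalC.
  rewrite derivC horner0 /pderiv big1 // => i _.
  by rewrite mderivC /peval mevalC mul0r.
- exists ((coordinates v i)%:P + coordinates w i *: 'X); split=> [t|].
    by rewrite !hornerE /peval mevalXU coordinatesD coordinatesZ mulrC.
  rewrite derivD derivC derivZ derivX add0r !hornerE /pderiv (bigD1 i) //= big1.
    by rewrite mderivXU eqxx /peval meval1 mul1r addr0.
  by move=> j /negPf ji; rewrite mderivXU ji /peval meval0 mul0r.
- exists (p' + q'); split=> [t|]; first by rewrite hornerD hp hq pevalD.
  rewrite derivD hornerD dp dq /pderiv -big_split; apply: eq_bigr => i _ /=.
  by rewrite mderivD pevalD mulrDl.
- exists (p' * q'); split=> [t|]; first by rewrite hornerM hp hq pevalM.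
  rewrite derivM hornerD !hornerM dp dq hp hq scale0r addr0.
  rewrite /pderiv mulr_suml mulr_sumr -big_split; apply: eq_bigr => i _ /=.
  by rewrite mderivM pevalD !pevalM mulrDl mulrA mulrAC.
Qed.

End LinearMaps.

(** [pderiv] depends only on the restriction to a line; this replaces the chain rule for linear
    changes of variables. *)
Lemma pderiv_chain (V W : vectType F) (P : polyfun V) (P' : polyfun W) v w v' w' :
  (forall t : F, peval P (v + t *: w) = peval P' (v' + t *: w')) ->
  pderiv P v w = pderiv P' v' w'.
Proof.
move=> h; have [q [hq <-]] := pderiv_line P v w; have [q' [hq' <-]] := pderiv_line P' v' w'.
suff -> : q = q' by [].
apply/eqP; rewrite -subr_eq0; apply/eqP/poly_vanish => t.
by rewrite hornerD hornerN hq hq' h subrr.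
Qed.

End PolynomialFunctions.

Section ZariskiTopology.
Variables (F : numFieldType).
Implicit Types (V W : vectType F).

Lemma zariski_closedP V (A : set (zariski V)) :
  closed A <-> exists S : set (polyfun V), A = zero_locus S.
Proof.
split=> [/closed_openC[S /setC_inj ->]|[S ->]]; first by exists S.
by rewrite -openC; exists S.
Qed.

Lemma zariski_closed_linear V W (L : 'Hom(V, W)) (A : set (zariski W)) :
  closed A -> closed ((fun v : zariski V => L v : zariski W) @^-1` A).
Proof.
move=> /zariski_closedP[S ->]; apply/zariski_closedP.
exists [set P' | exists2 P, S P & forall v, peval P' v = peval P (L v)].
apply/seteqP; split=> v /= hv.
  by move=> P' [P SP ->]; apply: hv.
move=> P SP; have [P' hP'] := peval_linear L P; rewrite -hP'.
by apply: hv; exists P.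
Qed.

Lemma zariski_open_linear V W (L : 'Hom(V, W)) (U : set (zariski W)) :
  open U -> open ((fun v : zariski V => L v : zariski W) @^-1` U).
Proof.
move=> oU; rewrite -[_ @^-1` _]setCK openC preimage_setC.
by apply: zariski_closed_linear; rewrite closedC.
Qed.

Definition vanishing V (A : set V) : polyfun V -> Prop :=
  fun P => forall v, A v -> peval P v = 0.

Lemma vanishing_ideal V (A : set V) : is_ideal (vanishing A).
Proof.
split=> [v _|P Q hP hQ v Av|P Q hQ v Av]; rewrite /peval.
- exact: mpoly.meval0.
- by rewrite mpoly.mevalD -!/(peval _ _) hP // hQ // addr0.
- by rewrite mpoly.mevalM -!/(peval _ _) hQ // mulr0.
Qed.

(** Closed sets correspond to their vanishing ideals with inclusions reversed, so noetherianity
    yields minimal closed sets. *)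
Lemma minimal_closed V (fat : set (zariski V) -> Prop) : fat setT ->
  exists C, [/\ closed C, fat C &
    forall C', closed C' -> fat C' -> C' `<=` C -> C `<=` C'].
Proof.
move=> fatT.
pose Z (J : polyfun V -> Prop) : set (zariski V) := zero_locus J.
have ZV (C : set (zariski V)) : closed C -> Z (@vanishing V C) = C.
  move=> /zariski_closedP[S ->]; apply/seteqP; split=> v /= hv P.
    by move=> SP; apply: hv => u; apply.
  by apply.
pose fam J := is_ideal J /\ fat (Z J).
have [||J [[idJ fatJ] _ maxJ]] := @noetherian_maximal _ fam
    (vanishing (setT : set V)) (@mpoly_noetherian F (\dim {:V})).
- by move=> J [].
- by split; [exact: vanishing_ideal | rewrite (ZV setT) //; exact: closedT].
exists (Z J); split=> //; first by apply/zariski_closedP; exists J.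
move=> C' clC' fatC' C'J; have JC' P : J P -> @vanishing V C' P.
  by move=> JP v /C'J; apply.
have := maxJ (@vanishing V C'); rewrite /fam (ZV C') // => /(_ (conj (vanishing_ideal _) fatC') JC') h.
by rewrite -(ZV C') // => v Jv P /h; apply: Jv.
Qed.

End ZariskiTopology.

(** * Connected linear groups are irreducible *)

Section ConnectedGroups.
Variables (F : numFieldType) (V : vectType F) (H : set 'End(V)).
Hypothesis groupH : linear_group H.
Let T := zariski 'End(V).
Let HT : set T := H.

Let irr_open (U : set T) := forall C D, closed C -> closed D ->
  HT `&` U `<=` C `|` D -> HT `&` U `<=` C \/ HT `&` U `<=` D.

Lemma lmul_lin (f : 'End(V)) : linear (fun x : 'End(V) => (f \o x)%VF).
Proof. by move=> a x y; rewrite comp_lfunDr -comp_lfunZr. Qed.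

Definition lmul (f : 'End(V)) : 'End('End(V)) :=
  linfun (HB.pack (fun x : 'End(V) => (f \o x)%VF)
    (GRing.isLinear.Build _ _ _ _ _ (lmul_lin f)) : {linear 'End(V) -> 'End(V)}).

Lemma lmulE f x : lmul f x = (f \o x)%VF.
Proof. by rewrite lfunE. Qed.

Lemma rmul_lin (f : 'End(V)) : linear (fun x : 'End(V) => (x \o f)%VF).
Proof. by move=> a x y; rewrite comp_lfunDl -comp_lfunZl. Qed.

Definition rmul (f : 'End(V)) : 'End('End(V)) :=
  linfun (HB.pack (fun x : 'End(V) => (x \o f)%VF)
    (GRing.isLinear.Build _ _ _ _ _ (rmul_lin f)) : {linear 'End(V) -> 'End(V)}).

Lemma rmulE f x : rmul f x = (x \o f)%VF.
Proof. by rewrite lfunE. Qed.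

Lemma groupVK f : H f -> (f^-1 \o f = \1)%VF /\ (f \o f^-1 = \1)%VF.
Proof.
case: groupH => HGL _ _ _ /HGL/eqP f0.
by split; apply/lfunP => x; rewrite comp_lfunE id_lfunE ?lker0_lfunK ?lker0_lfunVK.
Qed.

(** Take a minimal closed [C] containing a nonempty relatively open part of [H]. If that part is
    covered by [D1] and [D2] but not by [D1], removing [D1] leaves a nonempty open part inside [D2],
    so [C] lies in [D2] by minimality. *)
Lemma locally_irreducible_somewhere : exists U : set T,
  [/\ open U, HT `&` U !=set0 & irr_open U].
Proof.
pose fat (C : set T) := exists U, [/\ open U, HT `&` U !=set0 & HT `&` U `<=` C].
have [|C [clC [U [oU HU UC]] minC]] := @minimal_closed _ _ fat.
  exists setT; split; [exact: openT | | by []].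
  by case: groupH => _ H1 _ _; exists \1%VF.
exists U; split=> // D1 D2 cl1 cl2 U12.
have [h1|/existsNP[x /not_implyP[[Hx Ux] n1]]] := pselect (HT `&` U `<=` D1); first by left.
right; apply: (@subset_trans _ C) => //.
suff : C `<=` D2 `&` C by move=> h y /h[].
apply: minC; [exact: closedI | | by move=> y []].
exists (U `&` ~` D1); split; first by apply: openI => //; rewrite openC.
  by exists x.
move=> y [Hy [Uy nD1]]; split; last exact: UC.
by have [] := U12 y (conj Hy Uy).
Qed.

Lemma locally_irreducible x : H x -> exists U : set T, [/\ open U, U x & irr_open U].
Proof.
case: groupH => HGL H1 HM HV Hx.
have [U [oU [y [Hy Uy]] irrU]] := locally_irreducible_somewhere.
pose a : 'End(V) := (y \o x^-1)%VF; pose b : 'End(V) := (x \o y^-1)%VF.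
have [xV xV'] := groupVK Hx; have [yV yV'] := groupVK Hy.
have Ha : H a by apply: HM => //; apply: HV.
have Hb : H b by apply: HM => //; apply: HV.
have ab : (a \o b = \1)%VF.
  by rewrite /a /b comp_lfunA -(comp_lfunA y) xV comp_lfun1r.
have ba : (b \o a = \1)%VF.
  by rewrite /a /b comp_lfunA -(comp_lfunA x) yV comp_lfun1r.
exists ((fun f : T => lmul a f : T) @^-1` U); split.
- exact: zariski_open_linear.
- by rewrite /preimage /= lmulE /a -comp_lfunA xV comp_lfun1r.
move=> C D clC clD cov.
have [|||h|h] := irrU ((fun f : T => lmul b f : T) @^-1` C) ((fun f : T => lmul b f : T) @^-1` D).
- exact: zariski_closed_linear.
- exact: zariski_closed_linear.
- move=> f [Hf Uf]; apply: cov; split; first by rewrite lmulE; apply: HM.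
  by rewrite /preimage /= !lmulE comp_lfunA ab comp_lfun1l.
- left=> f [Hf Uf]; have := h (lmul a f); rewrite /preimage /= !lmulE comp_lfunA ba comp_lfun1l.
  by apply; split; [apply: HM | move: Uf; rewrite /preimage /= lmulE].
- right=> f [Hf Uf]; have := h (lmul a f); rewrite /preimage /= !lmulE comp_lfunA ba comp_lfun1l.
  by apply; split; [apply: HM | move: Uf; rewrite /preimage /= lmulE].
Qed.

(** The relative interior of a closed set [A] is also closed in [H]: an irreducible neighbourhood
    meeting it is contained in [A]. By connectedness it is empty or all of [H], and near 1 one of
    [C], [D] has interior. *)
Lemma connected_group_irreducible : connected HT -> irreducible HT.
Proof.
move=> conH; case: (groupH) => _ H1 _ _; split; first by exists \1%VF.
pose int (A : set T) : set T := [set x | HT x /\ exists U, [/\ open U, U x & HT `&` U `<=` A]].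
have int_clopen A : closed A -> int A !=set0 -> HT `<=` A.
  move=> clA intA0; suff <- : int A = HT by move=> x [Hx [U [_ Ux]]]; apply.
  apply: conH => //.
    exists (\bigcup_(U in [set U | open U /\ HT `&` U `<=` A]) U).
      by apply: bigcup_open => U [].
    apply/seteqP; split=> x; first by case=> Hx [U [oU Ux UA]]; split=> //; exists U.
    by case=> Hx [U [oU UA] Ux]; split=> //; exists U.
  pose W := \bigcup_(U in [set U | open U /\ HT `&` U `&` int A = set0]) U.
  exists (~` W); first by rewrite closedC; apply: bigcup_open => U [].
  apply/seteqP; split=> x.
    move=> ix; split; first by case: ix.
    case=> U [oU Ui] Ux; suff : set0 x by [].
    by rewrite -Ui; split=> //; split=> //; case: ix.
  case=> Hx nWx; apply: contrapT => nix; apply: nWx.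
  have [U [oU Ux irrU]] := locally_irreducible Hx; exists U => //; split=> //.
  apply/seteqP; split=> // z [[Hz Uz] [_ [U' [oU' U'z U'A]]]].
  have [||h|h] := irrU A (~` U') clA; first by rewrite closedC.
  - move=> u [Hu Uu]; have [U'u|] := pselect (U' u); last by right.
    by left; apply: U'A.
  - by apply: nix; split=> //; exists U.
  - by have := h z (conj Hz Uz); apply.
move=> C D clC clD cov.
have [iC|niC] := pselect (int C !=set0); first by left; apply: int_clopen.
right; apply: int_clopen => //; exists \1%VF; split=> //.
have [U [oU U1 irrU]] := locally_irreducible H1.
have [|h|h] := irrU C D clC clD.
- by move=> x [Hx _]; apply: cov.
- by case: niC; exists \1%VF; split=> //; exists U.
- by exists U.
Qed.

(** Conjugation by [f] is linear on End(V), preserves [H] and fixes the identity, so it preserves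
    the tangent space there. *)
Lemma lie_algebra_conj f X : H f -> lie_algebra_of H X ->
  lie_algebra_of H (f \o X \o f^-1)%VF.
Proof.
case: groupH => HGL H1 HM HV Hf LX P PH; have [fV fV'] := groupVK Hf.
pose L := (lmul f \o rmul f^-1)%VF.
have LE x : L x = (f \o x \o f^-1)%VF by rewrite comp_lfunE lmulE rmulE comp_lfunA.
have [P' hP'] := peval_linear L P.
rewrite -(LX P'); last first.
  by move=> x Hx; rewrite hP' LE; apply: PH; apply: (HM _ _ (HM _ _ Hf Hx) (HV _ Hf)).
apply: pderiv_chain => t; rewrite hP' linearD linearZ /= !LE comp_lfun1r fV'.
by [].
Qed.

End ConnectedGroups.

Lemma eval_lfun_lin (F : fieldType) (V : vectType F) (v : V) :
  linear (fun f : 'End(V) => f v).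
Proof. by move=> a f f'; rewrite add_lfunE scale_lfunE. Qed.

Definition eval_lfun (F : fieldType) (V : vectType F) (v : V) : 'Hom('End(V), V) :=
  linfun (HB.pack (fun f : 'End(V) => f v)
    (GRing.isLinear.Build _ _ _ _ _ (eval_lfun_lin v)) : {linear 'End(V) -> V}).

Lemma eval_lfunE (F : fieldType) (V : vectType F) (v : V) (f : 'End(V)) :
  eval_lfun v f = f v.
Proof. by rewrite lfunE. Qed.

(* Together with X, the K-translates of the curve form an irreducible subset of N,
   which is contained in the component X. *)
Lemma curve_meets_orbit (F : numFieldType) (V : vectType F) (K : set 'End(V))
    (N X : set (zariski V)) (e : V) (y : F -> V) :
  irreducible (K : set (zariski 'End(V))) -> K \1%VF ->
  irreducible_component N X -> open_in X (orbit_of K e) ->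
  (forall i, exists q : {poly F}, forall t, q.[t] = coordinates (y t) i) ->
  y 0 = e -> (forall f t, K f -> N (f (y t))) ->
  exists2 t, t != 0 & orbit_of K e (y t).
Proof.
move=> [_ irrK] K1 [XN [Xne irrX] maxX] [U oU orbE] polyy y0 KyN.
have curveP (P : polyfun V) : exists q : {poly F}, forall t, q.[t] = peval P (y t).
  exact: peval_curve.
have eU : U e.
  by have : orbit_of K e e by [exists \1%VF => //; rewrite id_lfunE]; rewrite orbE => -[].
have eX : X e.
  by have : orbit_of K e e by [exists \1%VF => //; rewrite id_lfunE]; rewrite orbE => -[].
pose D : set (zariski V) := [set v | exists f t, K f /\ v = f (y t)].
have irrcurve (f : 'End(V)) (C1 C2 : set (zariski V)) : closed C1 -> closed C2 ->
    (forall t, C1 (f (y t)) \/ C2 (f (y t))) ->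
    (forall t, C1 (f (y t))) \/ (forall t, C2 (f (y t))).
  move=> /zariski_closedP[S1 ->] /zariski_closedP[S2 ->] cov.
  apply: contrapT => /not_orP[/existsNP[t1 /existsNP[P1 /not_implyP[SP1 n1]]]].
  move=> /existsNP[t2 /existsNP[P2 /not_implyP[SP2 n2]]].
  have curve (P : polyfun V) : exists q : {poly F}, forall t, q.[t] = peval P (f (y t)).
    have [P' hP'] := peval_linear f P; have [q hq] := curveP P'.
    by exists q => t; rewrite hq hP'.
  have [q1 hq1] := curve P1; have [q2 hq2] := curve P2.
  have : q1 * q2 = 0.
    apply: poly_vanish => t; rewrite hornerM hq1 hq2.
    by have [/(_ _ SP1) ->|/(_ _ SP2) ->] := cov t; rewrite ?mul0r ?mulr0.
  move/eqP; rewrite mulf_eq0 => /orP[/eqP q0|/eqP q0].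
    by apply: n1; rewrite -hq1 q0 horner0.
  by apply: n2; rewrite -hq2 q0 horner0.
have irrD : irreducible D.
  split; first by exists e, \1%VF, 0; rewrite y0 id_lfunE.
  move=> C1 C2 cl1 cl2 cov.
  (* The endomorphisms that map the whole curve into [C]: each curve lies entirely in [C1] or in
     [C2], so irreducibility of [K] can be applied to these closed sets. *)
  pose A (C : set (zariski V)) : set (zariski 'End(V)) :=
    \bigcap_t ((fun f : zariski 'End(V) => eval_lfun (y t) f : zariski V) @^-1` C).
  have clA C : closed C -> closed (A C).
    by move=> clC; apply: closed_bigI => t _; apply: zariski_closed_linear.
  have [|||h|h] := irrK (A C1) (A C2); [exact: clA | exact: clA | | | ].
  - move=> f Kf; have [||t|h|h] := irrcurve f C1 C2 => //.
    + by apply: cov; exists f, t.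
    + by left=> t _; rewrite /preimage /= eval_lfunE.
    + by right=> t _; rewrite /preimage /= eval_lfunE.
  - by left=> _ [f [t [Kf ->]]]; have := h f Kf t Logic.I; rewrite /preimage /= eval_lfunE.
  - by right=> _ [f [t [Kf ->]]]; have := h f Kf t Logic.I; rewrite /preimage /= eval_lfunE.
have orbD : orbit_of K e `<=` D by move=> _ [f Kf <-]; exists f, 0; rewrite y0.
have dense (C : set (zariski V)) : closed C -> orbit_of K e `<=` C -> X `<=` C.
  move=> clC orbC; have [||//|h] := irrX C (~` U) clC; first by rewrite closedC.
    move=> x Xx; have [Ux|] := pselect (U x); last by right.
    by left; apply: orbC; rewrite orbE.
  by have := h e eX.
have XDX : X `|` D = X.
  apply: maxX; last by left.
    by move=> v [/XN //|[f [t [Kf ->]]]]; apply: KyN.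
  split; first by exists e; left.
  move=> C1 C2 cl1 cl2 cov.
  have [|h|h] := irrD.2 C1 C2 cl1 cl2; first by move=> v Dv; apply: cov; right.
    by left=> v [Xv|/h //]; apply: (dense C1) => //; apply: subset_trans orbD h.
  by right=> v [Xv|/h //]; apply: (dense C2) => //; apply: subset_trans orbD h.
have [S US] : zariski_open U by [].
have [P SP /eqP Pe] : exists2 P, S P & peval P e <> 0.
  move: eU; rewrite US => /existsNP[P /not_implyP[SP Pe]]; by exists P.
have [q hq] := curveP P.
(* [q] does not vanish at 0, so ['X * q] is a nonzero polynomial and is nonzero at some [t]. *)
have [t t0 qt] : exists2 t, t != 0 & q.[t] != 0.
  apply: contrapT => no; move/eqP: Pe; apply; rewrite -y0 -hq.
  suff /eqP : 'X * q = 0 by rewrite mulf_eq0 polyX_eq0 => /eqP ->; rewrite horner0.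
  apply: poly_vanish => t; rewrite hornerM hornerX; apply/eqP; rewrite mulf_eq0.
  apply: contrapT => /negP; rewrite negb_or => /andP[t0 qt]; apply: no; by exists t.
exists t => //; rewrite orbE; split.
  by rewrite -XDX; right; exists \1%VF, t; rewrite id_lfunE.
rewrite US => /(_ P SP)/eqP; apply/negP; by rewrite -hq.
Qed.

(** * Traces on the slice *)

Section TraceDerivation.
Variables (A : idomainType) (xi : A -> A).
Hypothesis xiD : forall a b, xi (a + b) = xi a + xi b.
Hypothesis xiM : forall a b, xi (a * b) = xi a * b + a * xi b.

Lemma derivation_mulmx n (X Y : 'M[A]_n) :
  map_mx xi (X *m Y) = map_mx xi X *m Y + X *m map_mx xi Y.
Proof.
apply/matrixP => i j; rewrite !mxE derivation_sum // -big_split.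
by apply: eq_bigr => l _; rewrite xiM !mxE.
Qed.

(** By Leibniz, [Y ^+ j] satisfies the same kind of equation with [j * s], and the trace kills the
    commutator. It is used with s = 2 for the Euler field and with s = 0 for tangent fields. *)
Lemma derivation_trace_power n (Y V : 'M[A]_n) s j :
  map_mx xi Y = s *: Y + (V *m Y - Y *m V) ->
  xi (\tr (Y ^+ j)) = j%:R * s * \tr (Y ^+ j).
Proof.
move=> hY; have xi_tr (X : 'M[A]_n) : xi (\tr X) = \tr (map_mx xi X).
  by rewrite /mxtrace derivation_sum //; apply: eq_bigr => l _; rewrite mxE.
suff hj : map_mx xi (Y ^+ j) = (j%:R * s) *: Y ^+ j + (V *m Y ^+ j - Y ^+ j *m V).
  by rewrite xi_tr hj linearD linearZ linearB /= mxtrace_mulC subrr addr0.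
elim: j => [|j IH].
  rewrite expr0 mul0r scale0r add0r mulmx1 mul1mx subrr; apply/matrixP => l m.
  by rewrite !mxE; case: (l == m); rewrite ?(derivation1 xiM) ?(derivation0 xiD).
rewrite exprS derivation_mulmx hY IH mulmxDl mulmxDr -scalemxAl -scalemxAr.
rewrite mulmxBl mulmxBr !mulmxA addrACA -scalerDl.
by congr (_ *: _ + _); [rewrite -natr1 mulrDl mul1r addrC | rewrite addrA subrK].
Qed.

End TraceDerivation.

(** * The generic slice matrix and its traces *)

Section GenericSlice.
Import multinomials.mpoly.
Variables (C : numClosedFieldType) (g : lieAlgType C) (e h f : g).
Hypothesis tr : sl2_triple e h f.
Variables (n : nat) (b : 'I_n -> g) (d : 'I_n -> nat).
Hypothesis hb : forall i, [lie h, b i] = - (d i)%:R *: b i.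

Definition ad_mx (x : g) := lfun_mx (ad x).

Lemma ad_mxD x y : ad_mx (x + y) = ad_mx x + ad_mx y.
Proof.
rewrite /ad_mx /lfun_mx -linearD /=; congr mxof; apply/lfunP => z.
by rewrite add_lfunE !adE lieDl.
Qed.

Lemma ad_mxZ a x : ad_mx (a *: x) = a *: ad_mx x.
Proof.
rewrite /ad_mx /lfun_mx -linearZ /=; congr mxof; apply/lfunP => z.
by rewrite scale_lfunE !adE lieZl.
Qed.

Lemma ad_mx0 : ad_mx 0 = 0.
Proof. by have := ad_mxZ 0 0; rewrite !scale0r. Qed.

Lemma ad_mx_sum I (s : seq I) (G : I -> g) : ad_mx (\sum_(i <- s) G i) = \sum_(i <- s) ad_mx (G i).
Proof. exact: (big_morph ad_mx ad_mxD ad_mx0). Qed.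

(** The order is reversed because matrices act on row vectors. *)
Lemma ad_mx_lie x y : ad_mx [lie x, y] = ad_mx y *m ad_mx x - ad_mx x *m ad_mx y.
Proof.
rewrite /ad_mx -!lfun_mx_comp /lfun_mx -linearB /=; congr mxof; apply/lfunP => z.
by rewrite add_lfunE opp_lfunE !comp_lfunE !adE lieA addrK.
Qed.

Definition slice_point (a : 'I_n -> C) : g := e + \sum_i a i *: b i.

Notation mxC := (map_mx (@mpolyC n C)).

Definition slice_mx : 'M[{mpoly C[n]}]_(\dim {:g}) :=
  mxC (ad_mx e) + \sum_i 'X_i *: mxC (ad_mx (b i)).

Lemma mxC_eval (a : 'I_n -> C) m l (X : 'M[C]_(m, l)) : map_mx (meval a) (mxC X) = X.
Proof. by apply/matrixP => i j; rewrite !mxE mevalC. Qed.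

Lemma slice_mx_eval a : map_mx (meval a) slice_mx = ad_mx (slice_point a).
Proof.
rewrite /slice_mx /slice_point map_mxD mxC_eval ad_mxD ad_mx_sum; congr (_ + _).
rewrite raddf_sum; apply: eq_bigr => i _ /=.
by rewrite map_mxZ mxC_eval ad_mxZ /= mevalXU.
Qed.

(** The shift leaves out the power 0, whose trace is a nonzero constant when g is nonzero. *)
Definition slice_trace j : {mpoly C[n]} := \tr (slice_mx ^+ j.+1).

Lemma map_mx_exp (A B : comNzRingType) (phi : {rmorphism A -> B}) m (X : 'M[A]_m) j :
  map_mx phi (X ^+ j) = map_mx phi X ^+ j.
Proof.
elim: j => [|j IH]; first by rewrite !expr0 map_mx1.
by rewrite !exprS map_mxM IH.
Qed.

Lemma slice_trace_eval a j : (slice_trace j).@[a] = \tr (ad_mx (slice_point a) ^+ j.+1).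
Proof. by rewrite -slice_mx_eval -map_mx_exp trace_map_mx. Qed.

Lemma slice_trace_nilpotent a :
  (forall j, (slice_trace j).@[a] = 0) <-> ad_nilpotent (slice_point a).
Proof.
split=> [h0|/lfun_mx_nilpotent[k Yk] j].
  by apply: lfun_trace0_nilpotent => -[//|j] _; rewrite -(h0 j) slice_trace_eval.
rewrite slice_trace_eval; apply: mx_nilpotent_trace0; exists k.
by rewrite -exprM mulnC exprM /ad_mx Yk expr0n.
Qed.

Section VectorField.
Variable beta : 'I_n -> {mpoly C[n]}.

Definition vfield (P : {mpoly C[n]}) := \sum_i beta i * P^`M(i).

Lemma vfieldD P Q : vfield (P + Q) = vfield P + vfield Q.
Proof.
by rewrite /vfield -big_split; apply: eq_bigr => i _; rewrite mderivD mulrDr.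
Qed.

Lemma vfieldM P Q : vfield (P * Q) = vfield P * Q + P * vfield Q.
Proof.
rewrite /vfield mulr_suml mulr_sumr -big_split; apply: eq_bigr => i _.
by rewrite /= mderivM; ring.
Qed.

Lemma vfieldC c : vfield c%:MP = 0.
Proof. by rewrite /vfield big1 // => i _; rewrite mderivC mulr0. Qed.

Lemma vfieldX i : vfield 'X_i = beta i.
Proof.
rewrite /vfield (bigD1 i) //= mderivXU eqxx mulr1 big1 ?addr0 // => j /negPf ji.
by rewrite mderivXU ji mulr0.
Qed.

Lemma vfield_slice_mx : map_mx vfield slice_mx = \sum_i beta i *: mxC (ad_mx (b i)).
Proof.
apply/matrixP => r s; rewrite mxE /slice_mx mxE !summxE vfieldD mxE vfieldC add0r.
rewrite (big_morph _ vfieldD (derivation0 vfieldD)); apply: eq_bigr => i _.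
by rewrite !mxE vfieldM vfieldC mulr0 addr0 vfieldX.
Qed.

End VectorField.

(** The rescaling t^2 Ad(t^(-h)) fixes e, of weight 2, and multiplies a vector of weight -d by t^(d
    + 2). *)
Let w i := (d i).+2.

Lemma euler_coef P m :
  (vfield (fun i => (w i)%:R * 'X_i) P)@_m = (wt w m)%:R * P@_m.
Proof.
elim/mpolyind: P => [|c m' P _ _ IH].
  by rewrite (derivation0 (@vfieldD _)) !mcoeff0 mulr0.
rewrite vfieldD !mcoeffD mulrDr IH; congr (_ + _).
have eX : vfield (fun i => (w i)%:R * 'X_i) 'X_[m'] = (wt w m')%:R * 'X_[m'].
  rewrite /vfield /wt natr_sum mulr_suml; apply: eq_bigr => i _.
  rewrite mderivX natrM -mulrA -scalerAr; case m'i: (m' i) => [|k].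
    by rewrite scale0r mulr0 !mul0r.
  rewrite -mpolyXD addmC submK; last by rewrite lep1mP m'i.
  by rewrite -mul_mpolyC mpolyC_nat mulrCA mulrA.
rewrite -mul_mpolyC vfieldM vfieldC mul0r add0r eX mulrCA -mpolyC_nat !mcoeffCM mcoeffX.
by case: eqP => [->|_]; rewrite ?mulr0.
Qed.

(* On the generic matrix of the slice, the Euler field of the weights w is multiplication
   by 2 plus the commutator with ad h, which the trace does not see. *)
Lemma slice_trace_homogeneous j m : m \in msupp (slice_trace j) -> wt w m = (2 * j.+1)%N.
Proof.
pose eta := vfield (fun i => (w i)%:R * 'X_i).
have etaY : map_mx eta slice_mx = 2%:R *: slice_mx +
    (mxC (ad_mx h) *m slice_mx - slice_mx *m mxC (ad_mx h)).
  have adh x a : [lie h, x] = a *: x ->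
      mxC (ad_mx h) *m mxC (ad_mx x) - mxC (ad_mx x) *m mxC (ad_mx h) = - a%:MP *: mxC (ad_mx x).
    move=> hx; rewrite -!map_mxM -map_mxB -opprB -ad_mx_lie hx ad_mxZ map_mxN map_mxZ.
    by rewrite scaleNr.
  rewrite vfield_slice_mx /slice_mx mulmxDr mulmxDl opprD addrACA.
  case: (tr) => he _ _; rewrite (adh _ _ he) scalerDr mpolyC_nat scaleNr addrACA subrr add0r.
  rewrite mulmx_sumr mulmx_suml -sumrB scaler_sumr -big_split; apply: eq_bigr => i _ /=.
  rewrite -scalemxAr -scalemxAl -scalerBr (adh _ _ (hb i)) !scalerA -scalerDl; congr (_ *: _).
  by rewrite mpolyCN mpolyC_nat opprK /w -addn2 natrD; ring.
move=> mc; have := congr1 (mcoeff m) (derivation_trace_power (@vfieldD _) (@vfieldM _) j.+1 etaY).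
rewrite -/(slice_trace j) euler_coef -natrM -mpolyC_nat mcoeffCM.
have m0 : (slice_trace j)@_m != 0 by rewrite -mcoeff_msupp.
by move/(mulIf m0)/eqP; rewrite eqr_nat mulnC => /eqP.
Qed.

End GenericSlice.

(** An eigenvector of the sum is pushed by [phi] into ker phi, where it becomes an eigenvector of
    [psi] for the same eigenvalue. *)
Lemma commuting_nilpotent_add (C : closedFieldType) (V : vectType C) (phi psi : 'End(V)) :
  (forall z, phi (psi z) = psi (phi z)) -> lfun_nilpotent phi -> lfun_nilpotent psi ->
  lfun_nilpotent (phi + psi).
Proof.
move=> comm [n phin] [m psim]; apply: lfun_eigenvalue0_nilpotent => c z z0 hz.
have [|j [w0 phiw]] := nilpotent_last (phi := phi) _ z0; first by exists n.
set w := iter j phi z in w0 phiw.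
have psiw : psi w = c *: w.
  rewrite -[psi w]add0r -phiw -add_lfunE /w.
  rewrite -(@iter_lfun_comm _ _ phi (phi + psi)) ?hz ?iter_lfunZ // => u.
  by rewrite !add_lfunE linearD /= comm.
have psik k : iter k psi w = c ^+ k *: w.
  by elim: k => [|k IH]; rewrite ?scale1r //= IH linearZ /= psiw scalerA exprSr.
apply/eqP; have /eqP := psik m; rewrite psim eq_sym scaler_eq0 (negPf w0) orbF expf_eq0.
by case/andP.
Qed.

(** * Nilpotent points and tangent fields on the slice *)

Section Slice.
Import multinomials.mpoly.
Variables (C : numClosedFieldType) (g : lieAlgType C) (e h f : g).
Hypothesis tr : sl2_triple e h f.
Variables (p : {vspace g}) (n : nat) (b : n.-tuple g) (d : 'I_n -> nat).
Hypothesis basis_b : basis_of (p :&: lker (ad f)) b.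
Hypothesis hb : forall i, [lie h, tnth b i] = - (d i)%:R *: tnth b i.
Hypothesis ep : e \in p.

Let b_slice i : tnth b i \in p /\ [lie f, tnth b i] = 0.
Proof.
have := basis_mem basis_b (mem_tnth i b).
by rewrite memv_cap memv_ker adE => /andP[-> /eqP].
Qed.

Let sum_p a : \sum_i a i *: tnth b i \in p.
Proof. by apply: memv_suml => i _; apply/memvZ/(b_slice i).1. Qed.

Let sum_f a : [lie f, \sum_i a i *: tnth b i] = 0.
Proof. by rewrite linear_sum /= big1 // => i _; rewrite lieZr (b_slice i).2 scaler0. Qed.

Let sum_eq0 (a : 'I_n -> C) : \sum_i a i *: tnth b i = 0 -> forall i, a i = 0.
Proof.
move=> h0; have /freeP fb := basis_free basis_b; apply: fb; rewrite -[RHS]h0.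
by apply: eq_bigr => i _; rewrite (tnth_nth 0).
Qed.

Lemma slice_nilpotent (K : set 'End(g)) (a : 'I_n -> C) :
  irreducible (K : set (zariski 'End(g))) -> K \1%VF ->
  (forall phi, K phi -> lie_automorphism phi) ->
  (forall phi x, K phi -> x \in p -> phi x \in p) ->
  principal_nilpotent K p e ->
  ad_nilpotent (slice_point e (tnth b) a) -> forall i, a i = 0.
Proof.
move=> irrK K1 Kaut Kp [X compX openX] nil_a.
pose w i := (d i).+2; pose y t := slice_point e (tnth b) (fun i => t ^+ w i * a i).
have ny t : ad_nilpotent (y t).
  (* Homogeneity multiplies the traces at [a] by powers of t; they vanish at [a], hence along the
     whole curve. *)
  apply/(slice_trace_nilpotent e (tnth b)) => j.
  have hom := slice_trace_homogeneous tr hb (j := j).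
  suff -> : (slice_trace e (tnth b) j).@[fun i => t ^+ w i * a i] =
      t ^+ (2 * j.+1) * (slice_trace e (tnth b) j).@[a].
    by rewrite (proj2 (slice_trace_nilpotent e (tnth b) a) nil_a) mulr0.
  rewrite !mevalE mulr_sumr; apply: eq_big_seq => m /hom <-.
  rewrite mulrCA; congr (_ * _); rewrite /wt expr_sum -big_split.
  by apply: eq_bigr => i _ /=; rewrite exprMn -exprM mulnC.
have phiy t phi : K phi -> nilpotent_cone p (phi (y t)).
  move=> Kphi; split; first by apply: Kp => //; apply: memvD => //; apply: sum_p.
  have [/eqP inj phiM] := Kaut _ Kphi; have [k yk] := ny t; exists k => z.
  have adphi u : iter k (ad (phi (y t))) (phi u) = phi (iter k (ad (y t)) u).
    by elim: k {yk} => //= k ->; rewrite !adE phiM.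
  by rewrite -(lker0_lfunVK inj z) adphi yk linear0.
have [|||t t0 [phi Kphi phie]] := curve_meets_orbit (y := y) irrK K1 compX openX.
- move=> i; exists ((coordinates e i)%:P + \sum_j (coordinates (tnth b j) i * a j) *: 'X^(w j)).
  move=> t; rewrite hornerD hornerC horner_sum /y /slice_point coordinatesD; congr (_ + _).
  rewrite /coordinates linear_sum; apply: eq_bigr => j _.
  by rewrite linearZ /= hornerZ hornerXn; ring.
- rewrite /y /slice_point big1 ?addr0 // => i _.
  by rewrite exprS mul0r mul0r scale0r.
- by move=> phi t Kphi; apply: phiy.
have := slice_orbit tr (Kaut _ Kphi) (sum_f _) phie.
move/sum_eq0 => a0 i; have /eqP := a0 i.
by rewrite mulf_eq0 expf_eq0 (negPf t0) andbF => /eqP.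
Qed.

Hypothesis slice_zero : forall a, ad_nilpotent (slice_point e (tnth b) a) -> forall i, a i = 0.
Hypothesis unc : forall D : C -> nat, exists N, forall M, exists s : seq C,
    [/\ uniq s, size s = M & forall x, x \in s -> (D x <= N)%N].

Lemma slice_vector_field0 (r : nat) (z : 'I_r -> g) (gam : 'I_r -> {mpoly C[n]})
    (beta : 'I_n -> {mpoly C[n]}) :
  (forall a : 'I_n -> C, [lie \sum_s (gam s).@[a] *: z s, slice_point e (tnth b) a] =
     \sum_i (beta i).@[a] *: tnth b i) ->
  forall i, beta i = 0.
Proof.
move=> tangent i; pose Y := slice_mx e (tnth b).
pose V := - \sum_s gam s *: map_mx (@mpolyC n C) (ad_mx (z s)).
(* The tangency is known pointwise; as an identity of polynomial matrices it may be checked at every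
   point. *)
have hY : map_mx (vfield beta) Y = 0 *: Y + (V *m Y - Y *m V).
  rewrite scale0r add0r vfield_slice_mx; apply/matrixP => r1 r2; apply/eqP.
  rewrite -subr_eq0; apply/eqP/mpoly_vanish => a.
  have evE (A B : 'M[{mpoly C[n]}]_(\dim {:g})) : map_mx (meval a) A = map_mx (meval a) B ->
      (A r1 r2 - B r1 r2).@[a] = 0.
    by move/matrixP/(_ r1 r2); rewrite !mxE mevalB => ->; rewrite subrr.
  apply: evE; rewrite map_mxB !map_mxM /= slice_mx_eval.
  have -> : map_mx (meval a) V = - ad_mx (\sum_s (gam s).@[a] *: z s).
    rewrite map_mxN ad_mx_sum raddf_sum /=; congr (- _); apply: eq_bigr => s _.
    by rewrite map_mxZ mxC_eval ad_mxZ.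
  rewrite mulNmx mulmxN opprK addrC -ad_mx_lie tangent ad_mx_sum raddf_sum /=.
  by apply: eq_bigr => s _; rewrite map_mxZ mxC_eval ad_mxZ.
rewrite -(vfieldX beta).
apply: (weighted_derivation0 (c := slice_trace e (tnth b)) (dg := (fun j => 2 * j.+1)%N)
  (w := fun i => (d i).+2)).
- by [].
- move=> j m; exact: (slice_trace_homogeneous tr hb).
- move=> a /slice_trace_nilpotent; exact: slice_zero.
- exact: unc.
- exact: vfieldD.
- exact: vfieldM.
- exact: vfieldC.
- move=> j; rewrite (derivation_trace_power (@vfieldD _ _ _) (@vfieldM _ _ _) j.+1 hY).
  by rewrite mulr0 mul0r.
Qed.

End Slice.

(** * Construction of a tangent vector field *)

Section TangentField.
Import multinomials.mpoly.
Variables (C : numClosedFieldType) (g : lieAlgType C) (e f : g).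
Variables (k p : {vspace g}) (n : nat) (b : n.-tuple g) (a0 : 'I_n -> C).
Hypothesis basis_b : basis_of (p :&: lker (ad f)) b.
Hypothesis ep : e \in p.
Hypothesis kp : forall x y, x \in k -> y \in p -> [lie x, y] \in p.
Let y a : g := slice_point e (tnth b) a.
Hypothesis transversal : forall t, t \in p -> exists v u,
  [/\ v \in k, u \in p, [lie f, u] = 0 & t = [lie v, y a0] + u].

Let pf := (p :&: lker (ad f))%VS.

Let bp i : tnth b i \in p.
Proof. by have := basis_mem basis_b (mem_tnth i b); rewrite memv_cap => /andP[]. Qed.

Let yp a : y a \in p.
Proof. by rewrite memvD // memv_suml // => i _; rewrite memvZ. Qed.

(* Cramer's rule for the equation [[v, y] = \sum_i beta_i b_i] in v, near a solution. *)
Lemma tangent_vector_field v0 : v0 \in k -> [lie f, [lie v0, y a0]] = 0 ->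
  [lie v0, y a0] != 0 ->
  exists r (z : 'I_r -> g) (gam : 'I_r -> {mpoly C[n]}) (beta : 'I_n -> {mpoly C[n]}),
    (forall a : 'I_n -> C,
      [lie \sum_s (gam s).@[a] *: z s, y a] = \sum_i (beta i).@[a] *: tnth b i) /\
    exists i, beta i != 0.
Proof.
move=> v0k fv0 v0n0.
(* [U1] completes p^f to p using only directions [v, y a0] with v in k, as transversality at [a0]
   allows. *)
pose U1 := ((ad (y a0) @: k) :\: pf)%VS; pose r := \dim U1.
pose B1 := vbasis U1.
have /choice[ks hks] (s : 'I_r) : exists v, v \in k /\ tnth B1 s = [lie v, y a0].
  have : tnth B1 s \in (ad (y a0) @: k)%VS.
    by apply: (subvP (diffvSl _ _)); apply: vbasis_mem; apply: mem_tnth.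
  case/memv_imgP => v vk ->; exists (- v); rewrite memvN; split=> //.
  by rewrite adE lieC lieNl.
have dxU : (U1 :&: pf)%VS = 0%VS by apply: capv_diff.
have pE : (U1 + pf)%VS = p.
  rewrite addv_diff; apply/eqP; rewrite eqEsubv; apply/andP; split.
    rewrite subv_add capvSl andbT; apply/subvP => _ /memv_imgP[v vk ->].
    by rewrite adE lieC memvN kp.
  apply/subvP => t /transversal[v [u [vk up fu ->]]]; apply: memv_add.
    by rewrite lieC -lieNr -adE memv_img // memvN.
  by rewrite memv_cap up memv_ker adE fu eqxx.
pose B := [tuple of B1 ++ b].
have bB : basis_of p B.
  by rewrite -pE; apply: cat_basis => //; [apply/directv_addP | apply: vbasisP].
have BE (z : g) : z \in p -> z = \sum_(s < r) coord B (lshift n s) z *: tnth B1 s +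
    \sum_(i < n) coord B (rshift r i) z *: tnth b i.
  move=> zp; rewrite {1}(coord_basis bB zp) big_split_ord /=; congr (_ + _);
    apply: eq_bigr => i _; congr (_ *: _).
    by rewrite -[in LHS](tnth_nth _ B (lshift n i)) tnth_lshift.
  by rewrite -[in LHS](tnth_nth _ B (rshift r i)) tnth_rshift.
have BB l l' : coord B l (tnth B l') = (l == l')%:R.
  by rewrite (tnth_nth 0) coord_free ?(basis_free bB) // eq_sym.
pose rowp (z : g) : 'rV[{mpoly C[n]}]_(r + n) := \row_l ((coord B l [lie z, e])%:MP +
   \sum_i (coord B l [lie z, tnth b i])%:MP * 'X_i).
have rowpE a z : map_mx (meval a) (rowp z) = \row_l coord B l [lie z, y a].
  apply/rowP => l; rewrite !mxE mevalD mevalC raddf_sum /= /y /slice_point lieDr linearD.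
  congr (_ + _); rewrite !linear_sum /=; apply: eq_bigr => i _.
  by rewrite mevalM mevalC mevalXU lieZr linearZ mulrC.
(* The rows of [M] are the coordinates of [ks s, y] and of the b_i, so that [M] is the identity at
   [a0]. *)
pose M1 : 'M[{mpoly C[n]}]_(r, r + n) := \matrix_(s, l) rowp (ks s) 0 l.
pose M : 'M[{mpoly C[n]}]_(r + n) := col_mx M1 (row_mx 0 1%:M).
(* With the adjugate in place of the inverse the solution stays polynomial: [det M * v0] minus the
   combination of the [ks] has its bracket with y in p^f, with coordinates the last entries of
   [al]. *)
pose al := rowp v0 *m \adj M.
have alM : al *m M = \det M *: rowp v0.
  by rewrite -mulmxA mul_adj_mx mul_mx_scalar.
pose D := \det M.
have key a l : \sum_(s < r) (al 0 (lshift n s)).@[a] * coord B l [lie ks s, y a] +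
    \sum_(i < n) (al 0 (rshift r i)).@[a] * (l == rshift r i)%:R =
    D.@[a] * coord B l [lie v0, y a].
  have /rowP/(_ l) := congr1 (map_mx (meval a)) alM.
  rewrite map_mxZ rowpE map_mxM !mxE => <-.
  rewrite big_split_ord /=; congr (_ + _); apply: eq_bigr => i _; rewrite !mxE.
    rewrite (unsplitK (inl i)) !mxE; congr (_ * _).
    by have /rowP/(_ l) := rowpE a (ks i); rewrite !mxE.
  rewrite (unsplitK (inr i)) !mxE; congr (_ * _).
  case: split_ordP => j ->; rewrite !mxE.
    by rewrite meval0 eq_lrshift.
  by rewrite eq_rshift eq_sym; case: (_ == _); rewrite ?meval1 ?meval0.
exists r.+1, (fun s => oapp ks v0 (unlift ord0 s)),
  (fun s => oapp (fun s' => - al 0 (lshift n s')) D (unlift ord0 s)),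
  (fun i => al 0 (rshift r i)); split.
  move=> a; rewrite big_ord_recl unlift_none /=.
  under eq_bigr do rewrite liftK /= mevalN scaleNr.
  rewrite sumrN lieDl lieNl lieZl.
  have suml : [lie \sum_s (al 0 (lshift n s)).@[a] *: ks s, y a] =
      \sum_s (al 0 (lshift n s)).@[a] *: [lie ks s, y a].
    rewrite (big_morph (fun x => [lie x, y a]) (fun x x' => lieDl x x' (y a)) (lie0l (y a))).
    by apply: eq_bigr => s _; rewrite lieZl.
  rewrite suml; apply/eqP; rewrite subr_eq addrC; apply/eqP.
  have inp : \sum_s (al 0 (lshift n s)).@[a] *: [lie ks s, y a] \in p.
    by apply: memv_suml => s _; rewrite memvZ // kp ?(hks s).1.
  have inp' : \sum_i (al 0 (rshift r i)).@[a] *: tnth b i \in p.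
    by apply: memv_suml => i _; rewrite memvZ.
  rewrite [LHS](coord_basis bB) ?memvZ ?kp // [RHS](coord_basis bB) ?memvD //.
  apply: eq_bigr => l _; congr (_ *: _).
  rewrite linearZ /= -key linearD !linear_sum /=; congr (_ + _); apply: eq_bigr => i _.
    by rewrite linearZ.
  by rewrite linearZ /= -(tnth_rshift B1 b i) -/B BB.
(* At [a0] the determinant is 1. If all [beta] vanished, [v0, y a0] would lie in [U1], hence be
   zero, as it also lies in p^f. *)
apply: contrapT => no; move/eqP: v0n0; apply.
have al0 i : (al 0 (rshift r i)) = 0.
  by apply/eqP; apply: contrapT => /negP h; apply: no; exists i.
have Mr s l : coord B l [lie ks s, y a0] = (l == lshift n s)%:R.
  by rewrite -(hks s).2 -(tnth_lshift B1 b s) -/B BB.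
have DE : D.@[a0] = 1.
  rewrite /D -[LHS]/((meval a0) _) -det_map_mx (_ : map_mx _ _ = 1%:M) ?det1 //.
  apply/matrixP => l l'; rewrite !mxE; case: split_ordP => j ->; rewrite !mxE.
    have /rowP/(_ l') := rowpE a0 (ks j); rewrite !mxE /= => ->.
    by rewrite Mr eq_sym.
  case: split_ordP => j' ->; rewrite !mxE /= ?eq_rlshift ?meval0 //.
  by rewrite eq_rshift; case: (_ == _); rewrite ?meval1 ?meval0.
have vp : [lie v0, y a0] \in p by apply: kp.
apply/eqP; rewrite -memv0 -dxU memv_cap; apply/andP; split; last first.
  by rewrite memv_cap vp memv_ker adE fv0 eqxx.
rewrite (BE _ vp) [X in _ + X]big1 ?addr0.
  by apply: memv_suml => s _; apply/memvZ/vbasis_mem/mem_tnth.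
move=> i _; have := key a0 (rshift r i); rewrite DE mul1r => <-.
rewrite !big1 ?addr0 ?scale0r // => j _; first by rewrite al0 meval0 mul0r.
by rewrite Mr eq_rlshift mulr0.
Qed.

End TangentField.

(** Conjugating ad v by an automorphism phi gives ad (phi v); conjugation preserves Lie(K) = ad k,
    and ad is faithful as the center is zero. *)
Lemma lie_group_preserves (F : numFieldType) (g : lieAlgType F) (K : set 'End(g))
    (k : {vspace g}) : lie_semisimple g -> linear_group K ->
  (forall phi, K phi -> lie_automorphism phi) ->
  lie_algebra_of K = [set ad x | x in [set x | x \in k]] ->
  forall phi x, K phi -> x \in k -> phi x \in k.
Proof.
move=> ss grK aut lieK phi v Kphi vk.
have : lie_algebra_of K (ad v) by rewrite lieK; exists v.
move/(lie_algebra_conj grK Kphi); rewrite lieK => -[v' /= v'k v'E].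
have [/eqP inj phiM] := aut _ Kphi.
suff -> : phi v = v' by [].
apply/eqP; rewrite -subr_eq0; apply/eqP; apply: semisimple_center => // z.
rewrite lieDl lieNl -(adE v') v'E !comp_lfunE adE phiM lker0_lfunVK //.
by rewrite subrr.
Qed.

(** * No nonzero element of p commutes with a principal triple; conclusion *)

Lemma principal_centralizer0 (R : realType) (g : lieAlgType R[i]) (theta : 'End(g))
    (K : set 'End(g)) (e h f x : g) :
  let k := fixedSpace theta in let p := leigenspace theta (-1) in
  (forall x y, theta [lie x, y] = [lie theta x, theta y]) ->
  (forall x, theta (theta x) = x) ->
  irreducible (K : set (zariski 'End(g))) -> K \1%VF ->
  (forall phi, K phi -> lie_automorphism phi) ->
  (forall phi x, K phi -> x \in p -> phi x \in p) ->
  principal_nilpotent K p e -> sl2_triple e h f ->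
  h \in k -> e \in p -> f \in p ->
  x \in p -> [lie h, x] = 0 -> [lie e, x] = 0 -> x = 0.
Proof.
move=> k p thM thK irrK K1 Kaut Kp prin tr hk ep fp xp hx ex.
have rep := sl2_triple_rep tr; case: (tr) => he hf ef.
(* [f, x] is killed by ad e and has weight -2, whereas ker (ad e) has no negative weight. *)
have fx : [lie f, x] = 0.
  have efx : ad e [lie f, x] = 0 by rewrite adE lieA ef hx ex lie0r addr0.
  have hfx : ad h [lie f, x] = - 2%:R *: [lie f, x].
    by rewrite adE lieA hf hx lie0r addr0 lieZl.
  have [n wE] := sl2_kerE_weight rep.
  apply/eqP; apply: contraT => fx0; have [i _ /eqP] := wE _ _ efx hfx fx0.
  by rewrite eq_sym -addr_eq0 -natrD pnatr_eq0 addn_eq0 andbF.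
have xe : [lie x, e] = 0 by rewrite lieC ex oppr0.
have xf : [lie x, f] = 0 by rewrite lieC fx oppr0.
have stab z : z \in (p :&: lker (ad f))%VS -> ad h z \in (p :&: lker (ad f))%VS.
  rewrite !memv_cap => /andP[zp]; rewrite memv_ker => /eqP fz.
  rewrite {1}adE (lie_kp thM hk zp) memv_ker.
  have := sl2_kerE_H (sl2_rep_sym rep) fz.
  by rewrite opp_lfunE linearN => /eqP; rewrite oppr_eq0.
have [X bX hX] := sl2_kerG_eigenbasis rep (capvSr _ _) stab.
pose b := in_tuple X; have bb : basis_of (p :&: lker (ad f)) b by [].
have /choice[d hd] (i : 'I_(size X)) : exists j, [lie h, tnth b i] = - j%:R *: tnth b i.
  by have [j hj] := hX _ (mem_tnth i b); exists j; rewrite -adE.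
have zero := slice_nilpotent tr bb hd ep irrK K1 Kaut Kp prin.
have xb : x \in (p :&: lker (ad f))%VS.
  apply/memv_capP; split; first exact: xp.
  by move/eqP: fx; rewrite -adE -memv_ker.
pose a i := coord b i x.
have xE : x = \sum_i a i *: tnth b i.
  rewrite {1}(coord_basis bb xb); apply: eq_bigr => i _.
  by rewrite (tnth_nth 0).
have ya : slice_point e (tnth b) a = e + x by rewrite /slice_point -xE.
have [nx|nnx] := pselect (lfun_nilpotent (ad x)).
  rewrite xE big1 // => i _; rewrite (zero a) ?scale0r // ya.
  rewrite /ad_nilpotent (_ : ad (e + x) = ad e + ad x); last first.
    by apply/lfunP => z; rewrite add_lfunE !adE lieDl.
  apply: commuting_nilpotent_add => // [z|]; last exact: (sl2_rep_nilpotent rep).1.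
  by rewrite !adE lieA ex lie0l add0r.
have /eqP te : theta e == - e by rewrite -mem_p.
have /eqP tf : theta f == - f by rewrite -mem_p.
have /eqP tx : theta x == - x by rewrite -mem_p.
have [v [tv fv v0]] := nonnilpotent_slice_direction thM thK tr te tf tx xe xf nnx.
have vk : v \in k by rewrite mem_k tv.
have trans t : t \in p -> exists v u, [/\ v \in k, u \in p, [lie f, u] = 0 &
    t = [lie v, slice_point e (tnth b) a] + u].
  by rewrite ya; exact: (centralizer_transversal thM thK tr ep fp xp xe xf).
rewrite -ya in fv v0.
have [r [z [gam [beta [tan [i ]]]]]] :=
  tangent_vector_field bb ep (lie_kp thM) trans vk fv v0.
by rewrite (slice_vector_field0 tr hd zero (@complex_uncountable R) tan) eqxx.
Qed.

Theorem theorem7 (R : realType) (g : lieAlgType R[i]) (theta : 'End(g))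
    (k p : {vspace g}) (G K : set 'End(g)) (e h f : g) :
  lie_semisimple g ->
  automorphism_of_order2 theta ->
  k = fixedSpace theta ->
  p = passmx.leigenspace theta (-1) ->
  adjoint_group G ->
  connected_subgroup_with_lie_algebra G K k ->
  principal_nilpotent K p e ->
  sl2_triple e h f ->
  h \in k -> e \in p -> f \in p ->
  \dim (ad_eigenspace h 0 :&: p) = \dim (ad_eigenspace h 2 :&: k).
Proof.
move=> ss [[_ thM] th2 _] -> -> [_ Gaut _] [[[grK _] conK] KG lieK] prin tr hk ep fp.
have thK x : theta (theta x) = x by rewrite -comp_lfunE th2 id_lfunE.
have Kaut phi : K phi -> lie_automorphism phi by move/KG/Gaut.
have Kk := lie_group_preserves ss grK Kaut lieK.
have K1 : K \1%VF by case: grK.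
apply: (triple_dim_eq thM tr) => // x xp hx ex.
apply: (principal_centralizer0 thM thK _ K1 Kaut _ prin tr hk ep fp xp hx ex).
  exact: connected_group_irreducible.
move=> phi z Kphi; apply: (automorphism_preserves_p thM thK ss (Kaut _ Kphi)) => y.
exact: Kk.
Qed.
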